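(* Let $\tau:\mathbb{T}\to\mathbb{T}$ be an ergodic measure-preserving transformation on $(\mathbb{T},m)$. Let $A_1,A_2$ be two disjoint Borel subsets of $[0,1)$ such that $A_1\cup A_2=[0,1)$ and $m(A_k)>0$ for $k=1,2$. Let $\phi_1,\phi_2\in H^\infty(\mathbb{D})$ be nonconstant on $\mathbb{D}$ and suppose that there exist $\lambda,\mu\in\mathbb{D}$ such that $$|\phi_1(\lambda)|^{m(A_1)}\,|\phi_2(\lambda)|^{m(A_2)}<1\quad\text{and}\quad |\phi_1(\mu)|^{m(A_1)}\,|\phi_2(\mu)|^{m(A_2)}>1.$$ Suppose that, for every $\omega\in\mathbb{T}$, the operator $T(\omega)$ on $H^2(\mathbb{D})$ is given by $T(\omega)=(M_{\phi_1})^*$ if $\omega\in A_1$ and $T(\omega)=(M_{\phi_2})^*$ if $\omega\in A_2$. Then the random sequence $(T_n(\cdot))_{n\ge1}$ is topologically mixing, that is, the sequence $(T_n(\omega))_{n\ge1}$ is topologically mixing for almost every $\omega\in\mathbb{T}$.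
   Context: $\mathbb{T}=\mathbb{R}/\mathbb{Z}$, identified with $[0,1)$, is equipped with its Borel sets and the normalized Lebesgue measure $m$. A Borel map $\tau:\mathbb{T}\to\mathbb{T}$ is measure-preserving if $m(\tau^{-1}(B))=m(B)$ for every Borel $B$, and ergodic if moreover $\tau^{-1}(B)=B$ implies $m(B)\in\{0,1\}$. For $\omega\in\mathbb{T}$ and $n\ge1$, $T_n(\omega):=T(\tau^{n-1}\omega)\cdots T(\tau\omega)T(\omega)$. A sequence $(S_n)_{n\ge1}$ of continuous maps on a space $X$ is topologically mixing if for all nonempty open $U,V\subset X$ one has $S_n(U)\cap V\neq\emptyset$ for all sufficiently large $n$. $\mathbb{D}$ is the open unit disk, $H^2(\mathbb{D})$ the Hardy (Hilbert) space, $H^\infty(\mathbb{D})$ the bounded holomorphic functions on $\mathbb{D}$. For $\phi\in H^\infty(\mathbb{D})$, $M_\phi f=\phi f$ on $H^2(\mathbb{D})$ and $(M_\phi)^*$ is its Hilbert space adjoint. *)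

(* Defs.v *)
From HB Require Import structures.
From mathcomp Require Import all_boot all_order all_algebra.
From mathcomp Require Import complex.
From mathcomp Require Import ring lra.
From mathcomp Require Import all_classical all_reals all_analysis.
Set Implicit Arguments.
Unset Strict Implicit.
Unset Printing Implicit Defensive.
Import Order.TTheory GRing.Theory Num.Theory Normc numFieldNormedType.Exports.
Local Open Scope classical_set_scope.
Local Open Scope ring_scope.

(* The library puts the norm topology on the alias R[i]^o only. *)
HB.instance Definition _ (R : realType) := NormedModule.copy R[i] R[i]^o.

Section l2.
Variable R : realType.
Implicit Types a b : nat -> R[i].

Definition sqsum a : R^nat := series (fun n => normc (a n) ^+ 2).

Definition square_summable : {pred nat -> R[i]} :=
  fun a => `[< cvgn (sqsum a) >].

Lemma sqsumS a n : sqsum a n.+1 = sqsum a n + normc (a n) ^+ 2.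
Proof. by rewrite /sqsum seriesSr. Qed.

Lemma sqsum_ge0 a n : 0 <= sqsum a n.
Proof. by rewrite /sqsum/series /=; apply: sumr_ge0 => i _; exact: sqr_ge0. Qed.

Lemma sqsum_nd a : {homo sqsum a : n m / (n <= m)%N >-> n <= m}.
Proof.
apply/nondecreasing_seqP => n.
by rewrite sqsumS lerDl sqr_ge0.
Qed.

Lemma sqsum_le_lim a n : cvgn (sqsum a) -> sqsum a n <= limn (sqsum a).
Proof. by move=> ca; exact: (nondecreasing_cvgn_le (@sqsum_nd a)). Qed.

Lemma sqsum_lim_ge0 a : cvgn (sqsum a) -> 0 <= limn (sqsum a).
Proof. by move=> ca; exact: le_trans (sqsum_ge0 a 0) (sqsum_le_lim _ ca). Qed.

Lemma sqsum_bounded a M : (forall n, sqsum a n <= M) -> cvgn (sqsum a).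
Proof.
move=> aM; apply: nondecreasing_is_cvgn; first exact: sqsum_nd.
by exists M => _ [n _ <-].
Qed.

Lemma normc_ge0 (z : R[i]) : 0 <= normc z.
Proof. by case: z => x y /=; exact: sqrtr_ge0. Qed.

Lemma sqrt_minkowski2 (x y u v : R) :
  Num.sqrt ((x + y) ^+ 2 + (u + v) ^+ 2) <=
  Num.sqrt (x ^+ 2 + u ^+ 2) + Num.sqrt (y ^+ 2 + v ^+ 2).
Proof. by exact: (le_normcD (Complex x u) (Complex y v)). Qed.

Lemma sqsum_minkowski a b n :
  Num.sqrt (sqsum (a + b) n) <= Num.sqrt (sqsum a n) + Num.sqrt (sqsum b n).
Proof.
elim: n => [|n ih].
  by rewrite /sqsum /series /= !big_geq// sqrtr0 addr0.
rewrite !sqsumS.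
have e c : sqsum c n = Num.sqrt (sqsum c n) ^+ 2.
  by rewrite sqr_sqrtr // sqsum_ge0.
rewrite (e a) (e b).
apply: le_trans (sqrt_minkowski2 _ _ _ _).
apply: ler_wsqrtr; apply: lerD.
  by rewrite e; apply: lerXn2r; rewrite // nnegrE ?addr_ge0 ?sqrtr_ge0.
apply: lerXn2r; rewrite ?nnegrE ?normc_ge0 ?addr_ge0 ?normc_ge0//.
exact: le_normcD.
Qed.

Lemma sqsum_scale (k : R[i]) a n :
  sqsum (fun m => k * a m) n = normc k ^+ 2 * sqsum a n.
Proof.
rewrite /sqsum /series /= mulr_sumr; apply: eq_bigr => i _.
by rewrite normcM exprMn.
Qed.

Lemma square_summableP a : reflect (cvgn (sqsum a)) (a \in square_summable).
Proof. exact: asboolP. Qed.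

Lemma square_summableD a b : a \in square_summable -> b \in square_summable ->
  a + b \in square_summable.
Proof.
move=> /square_summableP ca /square_summableP cb; apply/square_summableP.
apply: (@sqsum_bounded _ ((Num.sqrt (limn (sqsum a)) +
                           Num.sqrt (limn (sqsum b))) ^+ 2)) => n.
rewrite -[leLHS]sqr_sqrtr ?sqsum_ge0//; apply: lerXn2r.
- by rewrite nnegrE sqrtr_ge0.
- by rewrite nnegrE addr_ge0// sqrtr_ge0.
apply: le_trans (sqsum_minkowski _ _ _) _.
by apply: lerD; apply: ler_wsqrtr; exact: sqsum_le_lim.
Qed.

Lemma square_summableZ (k : R[i]) a : a \in square_summable ->
  k *: a \in square_summable.
Proof.
move=> /square_summableP ca; apply/square_summableP.
apply: (@sqsum_bounded _ (normc k ^+ 2 * limn (sqsum a))) => n.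
rewrite [leLHS]sqsum_scale ler_wpM2l ?sqr_ge0//; exact: sqsum_le_lim.
Qed.

Lemma square_summable_submod : submod_closed square_summable.
Proof.
split.
  apply/square_summableP/(@sqsum_bounded _ 0) => n.
  rewrite /sqsum /series /= big1// => i _.
  by rewrite expr0n addr0 sqrtr0 expr0n.
by move=> k a b Sa Sb; apply: square_summableD Sb; exact: square_summableZ.
Qed.

HB.instance Definition _ := GRing.isSubmodClosed.Build _ _ square_summable
  square_summable_submod.

End l2.

(* H^2(D): the functions f(z) = \sum_n a_n z^n on the open unit disk D with
   \sum_n |a_n|^2 < +oo, normed by (\sum_n |a_n|^2)^(1/2).  An element is stored
   as its sequence (a_n) of Taylor coefficients at 0, which is determined by the
   function on D (lemma hardy_eqP); it coerces to that function. *)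
Record hardy (R : realType) := Hardy {
  taylor : nat -> R[i];
  _ : taylor \in @square_summable R }.

HB.instance Definition _ (R : realType) := [isSub for @taylor R].
HB.instance Definition _ (R : realType) := [Choice of hardy R by <:].
HB.instance Definition _ (R : realType) :=
  [SubChoice_isSubLmodule of hardy R by <:].

Section hardy_space.
Variable R : realType.
Implicit Types f g : hardy R.

Definition unit_disk : set R[i] := [set z | normc z < 1].

Definition hardy_fun f (z : R[i]) : R[i] :=
  limn (series (fun n => taylor f n * z ^+ n)).

Definition hardy_norm f : R := Num.sqrt (limn (sqsum (taylor f))).

Definition hardy_dot f g : R[i] :=
  limn (series (fun n => taylor f n * conjc (taylor g n))).

Lemma cvg_sqsum_taylor f : cvgn (sqsum (taylor f)).
Proof. by apply/square_summableP; case: f. Qed.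

Let hnorm f : R[i] := real_complex R (hardy_norm f).

Let hnormD f g : hnorm (f + g) <= hnorm f + hnorm g.
Proof.
rewrite /hnorm -rmorphD /= lecR /hardy_norm.
set s := (X in _ <= X).
have s0 : 0 <= s by rewrite addr_ge0// sqrtr_ge0.
rewrite -(ler_pXn2r (ltn0Sn 1)) ?nnegrE ?sqrtr_ge0//.
rewrite sqr_sqrtr ?sqsum_lim_ge0//; last exact: cvg_sqsum_taylor.
apply: limr_le; first exact: cvg_sqsum_taylor.
apply: nearW => n.
rewrite -[leLHS]sqr_sqrtr ?sqsum_ge0//; apply: lerXn2r => //.
- by rewrite nnegrE sqrtr_ge0.
apply: le_trans (sqsum_minkowski _ _ _) _.
apply: lerD; apply: ler_wsqrtr; apply: sqsum_le_lim; exact: cvg_sqsum_taylor.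
Qed.

Let hnormZ (k : R[i]) f : hnorm (k *: f) = `|k| * hnorm f.
Proof.
rewrite /hnorm.
have -> : `|k| = real_complex R (normc k) by [].
rewrite -rmorphM /=; congr (real_complex R _); rewrite /hardy_norm.
have -> : sqsum (taylor (k *: f)) = (fun n => normc k ^+ 2 * sqsum (taylor f) n).
  by apply/funext => n; rewrite -sqsum_scale.
rewrite (_ : limn _ = normc k ^+ 2 * limn (sqsum (taylor f))); last first.
  apply/cvg_lim => //; apply: cvgMl_tmp; exact: cvg_sqsum_taylor.
by rewrite sqrtrM ?sqr_ge0// sqrtr_sqr ger0_norm// normc_ge0.
Qed.

Let hnorm_eq0 f : hnorm f = 0 -> f = 0.
Proof.
move=> /complexI /eqP; rewrite sqrtr_eq0 => l0.
apply/val_inj/funext => n /=.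
apply/eq0_normc/eqP; rewrite -sqrf_eq0 -[_ == 0]andbT eq_le sqr_ge0 !andbT.
apply: le_trans l0.
apply: le_trans (sqsum_le_lim n.+1 (@cvg_sqsum_taylor f)).
by rewrite sqsumS lerDr sqsum_ge0.
Qed.

HB.instance Definition _ := Lmodule_isNormed.Build R[i] (hardy R)
  hnormD hnormZ hnorm_eq0.

Lemma hardy_normE f : `|f| = real_complex R (hardy_norm f).
Proof. by []. Qed.

End hardy_space.

Coercion hardy_fun : hardy >-> Funclass.

Section hardy_separation.
Variable R : realType.
Implicit Types (f g : hardy R) (a u : nat -> R[i]).

Lemma cvg_complex u (x y : R) : complex.Re (u n) @[n --> \oo] --> x ->
  complex.Im (u n) @[n --> \oo] --> y -> u n @[n --> \oo] --> Complex x y.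
Proof.
move=> ux uy; apply/cvgrPdist_lt => -[e i]; rewrite ltcE /= => /andP[/eqP-> e0].
have e2 : 0 < e / 2 by rewrite divr_gt0.
move/cvgrPdist_lt : ux => /(_ _ e2) ux; move/cvgrPdist_lt : uy => /(_ _ e2) uy.
near=> n.
have -> : `|Complex x y - u n| = real_complex R (normc (Complex x y - u n)) by [].
rewrite (_ : Complex e 0 = real_complex R e)// ltcR.
have -> : Complex x y - u n =
    Complex (x - complex.Re (u n)) 0 + Complex 0 (y - complex.Im (u n)).
  by case: (u n) => p q; rewrite /GRing.add /GRing.opp /= addr0 add0r.
apply: le_lt_trans (le_normcD _ _) _.
rewrite /= expr0n addr0 add0r !sqrtr_sqr [e]splitr.
by apply: ltrD; near: n.
Unshelve. all: by end_near. Qed.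

Lemma complex_normed_cvg a :
  cvgn (series (fun n => normc (a n))) -> cvgn (series a).
Proof.
move=> ca.
have cr (p : R[i] -> R) : {morph p : x y / x + y} -> p 0 = 0 ->
    (forall z, `|p z| <= normc z) -> cvgn (fun n => p (series a n)).
  move=> pD p0 pn.
  rewrite (_ : (fun n => _) = series (fun n => p (a n))); last first.
    by apply/funext => n; rewrite /series /= (big_morph p pD p0).
  apply: normed_cvg; apply: (series_le_cvg _ _ _ ca) => n /=.
  - exact: normr_ge0.
  - exact: normc_ge0.
  - exact: pn.
have cRe : cvgn (fun n => complex.Re (series a n)).
  apply: cr => // [[? ?] [? ?]//|[x y]] /=.
  by rewrite -sqrtr_sqr ler_wsqrtr// lerDl sqr_ge0.
have cIm : cvgn (fun n => complex.Im (series a n)).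
  apply: cr => // [[? ?] [? ?]//|[x y]] /=.
  by rewrite -sqrtr_sqr ler_wsqrtr// lerDr sqr_ge0.
by apply/cvg_ex; eexists; apply: cvg_complex; [exact: cRe|exact: cIm].
Qed.

Lemma square_summable_bounded a : a \in @square_summable R ->
  exists2 M, 0 <= M & forall n, normc (a n) <= M.
Proof.
move=> /square_summableP ca; exists (Num.sqrt (limn (sqsum a))).
  exact: sqrtr_ge0.
move=> n; rewrite -[leLHS]ger0_norm ?normc_ge0// -sqrtr_sqr ler_wsqrtr//.
apply: le_trans (sqsum_le_lim n.+1 ca).
by rewrite sqsumS lerDr sqsum_ge0.
Qed.

Lemma normcX (z : R[i]) n : normc (z ^+ n) = normc z ^+ n.
Proof. by elim: n => [|n ih]; [exact: normc1|rewrite !exprS normcM ih]. Qed.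

Lemma hardy_cvg f (z : R[i]) : unit_disk z ->
  series (fun n => taylor f n * z ^+ n) @ \oo --> f z.
Proof.
move=> z1; have [M M0 fM] : exists2 M, 0 <= M & forall n, normc (taylor f n) <= M.
  by apply: square_summable_bounded; case: f.
apply: complex_normed_cvg.
apply: (@series_le_cvg _ _ (fun n => M * normc z ^+ n)) => [n|n|n|].
- exact: normc_ge0.
- by rewrite mulr_ge0// exprn_ge0// normc_ge0.
- by rewrite normcM normcX ler_wpM2r// exprn_ge0// normc_ge0.
- by apply: is_cvg_geometric_series; rewrite ger0_norm// normc_ge0.
Qed.

Lemma power_series_eq0 a (M : R) : (forall n, normc (a n) <= M) ->
  (forall z, unit_disk z -> series (fun n => a n * z ^+ n) @ \oo --> (0 : R[i])) ->
  forall n, a n = 0.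
Proof.
move=> aM a0; elim/ltn_ind => k ih.
have M0 : 0 <= M by exact: le_trans (normc_ge0 _) (aM 0%N).
have key (t : R) : 0 < t -> t <= 2^-1 -> normc (a k) <= 2 * M * t.
  move=> t0 t2.
  set z := real_complex R t.
  have nz : normc z = t by rewrite /z /= expr0n addr0 sqrtr_sqr gtr0_norm.
  set P := series (fun n => a n * z ^+ n).
  have PS n : P n.+1 = P n + a n * z ^+ n by rewrite /P seriesSr.
  have P0 n : (n <= k)%N -> P n = 0.
    elim: n => [_|n ihn nk]; first by rewrite /P /series /= big_geq.
    by rewrite PS ihn ?(ltnW nk)// ih// mul0r addr0.
  have tail n : normc (P (n + k.+1)%N - P k.+1) <=
      2 * M * (t ^+ k.+1 - t ^+ (n + k.+1)).
    elim: n => [|n ihn]; first by rewrite add0n !subrr mulr0 normc0.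
    rewrite addSn PS addrAC; apply: le_trans (le_normcD _ _) _.
    set q := t ^+ (n + k.+1); rewrite -/q in ihn.
    have q0 : 0 <= q by rewrite exprn_ge0// ltW.
    have : normc (a (n + k.+1)%N * z ^+ (n + k.+1)) <= M * q.
      by rewrite normcM normcX nz ler_wpM2r.
    have : t * q <= 2^-1 * q by rewrite ler_wpM2r.
    rewrite [t ^+ (n + k.+1).+1]exprS -/q => /(ler_wpM2l M0) h1 h2.
    apply: le_trans (lerD ihn h2) _.
    rewrite -subr_ge0 (_ : _ - _ = 2 * (M * (2^-1 * q) - M * (t * q))); last first.
      by field.
    by rewrite mulr_ge0// subr_ge0.
  have : normc (P k.+1) <= 2 * M * t ^+ k.+1.
    apply/ler_addgt0Pr => e e0.
    have /a0/cvgrPdist_lt : unit_disk z.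
      by rewrite /unit_disk /mkset nz (le_lt_trans t2)// invf_lt1// ltr1n.
    move=> /(_ (real_complex R e)); rewrite ltcR => /(_ e0) [N _ HN].
    have := HN (N + k.+1)%N (leq_addr _ _).
    rewrite /= sub0r normrN -/P.
    have -> : `|P (N + k.+1)%N| = real_complex R (normc (P (N + k.+1)%N)) by [].
    rewrite ltcR => /ltW Ne.
    rewrite (_ : P k.+1 = P (N + k.+1)%N + - (P (N + k.+1)%N - P k.+1)); last first.
      by rewrite opprB addrC subrK.
    apply: le_trans (le_normcD _ _) _; rewrite normcN addrC lerD//.
    apply: le_trans (tail N) _; rewrite ler_wpM2l ?mulr_ge0//.
    by rewrite gerBl exprn_ge0// ltW.
  rewrite PS P0// add0r normcM normcX nz exprSr mulrA.
  by rewrite mulrAC ler_pM2r// exprn_gt0.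
apply/eq0_normc/eqP; rewrite eq_le normc_ge0 andbT; apply/ler_addgt0Pr => e e0.
rewrite add0r.
set t := Num.min 2^-1 (e / (2 * M + 1)).
have M1 : 0 < 2 * M + 1 by rewrite ltr_wpDl// mulr_ge0.
have t0 : 0 < t by rewrite lt_min invr_gt0 ltr0n divr_gt0.
apply: le_trans (key t t0 _) _; first by rewrite ge_min lexx.
have : t <= e / (2 * M + 1) by rewrite ge_min lexx orbT.
rewrite ler_pdivlMr// mulrDr mulr1 [t * _]mulrC.
by move=> /(le_trans _); apply; rewrite lerDl ltW.
Qed.

Lemma hardy_eqP f g : f = g <-> (forall z, unit_disk z -> f z = g z).
Proof.
split=> [->//|fg].
have [M M0 hM] : exists2 M, 0 <= M & forall n, normc (taylor (f - g) n) <= M.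
  by apply: square_summable_bounded; case: (f - g).
apply/eqP; rewrite -subr_eq0; apply/eqP/val_inj/funext => /=.
apply: (@power_series_eq0 _ M) => // z z1.
set A := series (fun n => taylor f n * z ^+ n).
set B := series (fun n => taylor g n * z ^+ n).
have cA : A @ \oo --> f z by exact: hardy_cvg.
have cB : B @ \oo --> f z by rewrite (fg z z1); exact: hardy_cvg.
rewrite [X in X @ _](_ : _ = A - B); last first.
  apply/funext => n; rewrite [RHS](_ : _ = A n - B n)// /A /B /series /= -sumrB.
  by apply: eq_bigr => i _; rewrite -mulrBl.
by rewrite -(subrr (f z)); exact: cvgB.
Qed.

End hardy_separation.

Section multipliers.
Variable R : realType.
Implicit Types (phi : R[i] -> R[i]) (M S : hardy R -> hardy R).

(* The increment of the library's directional derivative ranges over R[i], so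
   derivability in the direction 1 is complex differentiability. *)
Definition holomorphic_disk phi := forall z, unit_disk z -> derivable phi z 1.

Definition bounded_disk phi :=
  exists C : R, forall z, unit_disk z -> normc (phi z) <= C.

Definition Hinfty phi := holomorphic_disk phi /\ bounded_disk phi.

Definition nonconstant_disk phi :=
  exists z w, [/\ unit_disk z, unit_disk w & phi z != phi w].

Definition is_mul_op phi M :=
  forall f z, unit_disk z -> M f z = phi z * f z.

Definition is_adjoint M S :=
  forall f g, hardy_dot (M f) g = hardy_dot f (S g).

(* S = (M_phi)^*.  For phi in H^oo exactly one M satisfies is_mul_op phi M,
   namely M_phi, and exactly one S satisfies is_adjoint M_phi S. *)
Definition is_mul_op_adjoint phi S :=
  exists2 M, is_mul_op phi M & is_adjoint M S.

End multipliers.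

Section circle_dynamics.
Variable R : realType.
Implicit Types (tau : R -> R) (B : set R).

Definition circle : set R := `[0, 1[.

(* A self-map of the circle is given by a function on R that maps [0, 1[ to
   itself; its values off [0, 1[ are irrelevant. *)
Definition measure_preserving tau :=
  [/\ set_fun circle circle tau,
      measurable_fun circle tau &
      forall B, measurable B -> B `<=` circle ->
        lebesgue_measure (circle `&` tau @^-1` B) = lebesgue_measure B].

Definition ergodic tau :=
  measure_preserving tau /\
  forall B, measurable B -> B `<=` circle -> circle `&` tau @^-1` B = B ->
    lebesgue_measure B = 0%E \/ lebesgue_measure B = 1%E.

(* T (tau^(n-1) w) \o ... \o T (tau w) \o T w *)
Fixpoint random_product (X : Type) (T : R -> X -> X) tau (n : nat) (w : R)
    : X -> X :=
  if n is m.+1 then T (iter m tau w) \o random_product T tau m w else id.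

End circle_dynamics.
Arguments circle : clear implicits.

(* The maps S 1, S 2, ... matter; S 0 is irrelevant. *)
Definition topologically_mixing (X : topologicalType) (S : nat -> X -> X) :=
  forall U V : set X, open U -> open V -> U !=set0 -> V !=set0 ->
    \forall n \near \oo, (S n @` U) `&` V !=set0.

(* Main.v *)
(* The operators T(w) are linear and multiply the reproducing kernel of H^2 at
   z by conj(phi_k(z)), so T_n(w) multiplies it by a number of modulus
   |phi_1(z)|^(a_n) |phi_2(z)|^(b_n), where a_n and b_n count the visits of the
   orbit of w to A_1 and A_2 before time n.  By Birkhoff's theorem a_n / n and
   b_n / n tend to m(A_1) and m(A_2) almost surely; hence this modulus tends to
   0 for z near lambda and to infinity for z near mu.  Kernels at the points of
   any disk span a dense subspace, so a point of U is approximated by some x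
   with T_n x -> 0, a point of V by some y admitting s_n -> 0 with T_n s_n = y,
   and x + s_n is mapped by T_n to T_n x + y. *)
From HB Require Import structures.
Require Import Defs.
From mathcomp Require Import all_boot all_order all_algebra.
From mathcomp Require Import complex.
From mathcomp Require Import ring lra.
From mathcomp Require Import all_classical all_reals all_analysis.
From mathcomp Require Import measurable_realfun.
Set Implicit Arguments.
Unset Strict Implicit.
Unset Printing Implicit Defensive.
Import Order.TTheory GRing.Theory Num.Theory Normc numFieldNormedType.Exports.
Local Open Scope classical_set_scope.
Local Open Scope ring_scope.

(** * Visits of an ergodic map *)

(** Since a_n + b_n = n, an upper bound on the visits to each of the two sets is a lower bound on
    the visits to the other, so only upper bounds (m(A) + e) n + K are proved, with K depending on
    the orbit. The exceptional null set is fixed before any kernel is chosen, so one null set serves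
    the uncountably many points z. The growth estimate takes logarithms of moduli, whereas
    phi_k(lambda) may vanish. The moduli at lambda are therefore replaced by larger constants r_k >
    0 and those at mu by smaller constants s_k > 0 that keep the two strict inequalities; continuity
    carries these bounds to whole balls. Density is proved by explicit approximation. A kernel K v
    times a product of n Blaschke factors with zeros coming from the given disk is a combination of
    kernels with the same norm as K v, in which K v has a coefficient growing geometrically in n.
    Dividing by that coefficient shows that K v is close to the span of the other kernels. *)

Section visits.
Context d (X : measurableType d) (R : realType) (P : probability X R).
Variables (tau : X -> X) (A : set X).
Hypotheses (mtau : measurable_fun setT tau)
  (Ptau : forall B, measurable B -> P (tau @^-1` B) = P B)
  (mA : measurable A).

Definition visits n x : R := \sum_(k < n) \1_A (iter k tau x).

Lemma visitsSl n x : visits n.+1 x = \1_A x + visits n (tau x).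
Proof.
rewrite /visits big_ord_recl /=; congr +%R.
by apply: eq_bigr => i _; rewrite -iterSr.
Qed.

(* The maximum of visits n x - q * n over n <= N, computed along the orbit. *)
Fixpoint max_dev (q : R) N x : R :=
  if N is M.+1 then Num.max 0 (\1_A x - q + max_dev q M (tau x)) else 0.

Lemma max_dev_ge0 (q : R) N x : 0 <= max_dev q N x.
Proof. by case: N => //= N; rewrite le_max lexx. Qed.

Lemma max_devS (q : R) N x : max_dev q N x <= max_dev q N.+1 x.
Proof.
elim: N x => [x|N ih x]; first exact: max_dev_ge0.
rewrite [leLHS]/=.
rewrite [leRHS](_ : _ = Num.max 0 (\1_A x - q + max_dev q N.+1 (tau x)))//.
by rewrite ge_max !le_max lexx lerD2l ih orbT.
Qed.

Lemma visits_le_max_dev (q : R) N x : visits N x - q * N%:R <= max_dev q N x.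
Proof.
elim: N x => [x|N ih x]; first by rewrite /visits big_ord0 mulr0 subr0.
rewrite visitsSl /= le_max; apply/orP; right.
by have := ih (tau x); rewrite -natr1 mulrDr mulr1; lra.
Qed.

Lemma measurable_max_dev (q : R) N : measurable_fun setT (max_dev q N).
Proof.
elim: N => [|N ih]; first exact: measurable_cst.
apply: measurable_maxr; first exact: measurable_cst.
apply: measurable_funD; first by apply: measurable_funB => //;
  exact: measurable_indic.
exact: measurableT_comp.
Qed.

Lemma measurable_visits n : measurable_fun setT (visits n).
Proof.
elim: n => [|n ih].
  by rewrite (_ : visits 0 = cst 0)//; apply/funext => x;
    rewrite /visits big_ord0.
rewrite (_ : visits n.+1 = fun x => \1_A x + visits n (tau x)); last first.
  by apply/funext => x; rewrite visitsSl.
by apply: measurable_funD; [exact: measurable_indic|exact: measurableT_comp].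
Qed.

Lemma max_dev_le (q : R) N x : 0 <= q -> max_dev q N x <= N%:R.
Proof.
move=> q0; elim: N x => [x|N ih x]//=.
rewrite ge_max ler0n /=; have := ih (tau x).
have : \1_A x <= 1 :> R by rewrite indicE; case: (_ \in _).
rewrite -natr1; lra.
Qed.

Let mpos (q : R) N : measurable [set x | 0 < max_dev q N x].
Proof.
rewrite (_ : [set x | _] = setT `&` max_dev q N @^-1` `]0, +oo[).
  by apply: measurable_max_dev => //; exact: measurable_itv.
by rewrite setTI; apply/seteqP; split => x /=; rewrite in_itv/= andbT.
Qed.

(* Garsia's argument: on [0 < max_dev q N] the recursion reads
   max_dev q N = 1_A - q + max_dev q N.-1 \o tau. *)
Lemma maximal_ergodic (q : R) N : 0 <= q ->
  (q%:E * P [set x | (0 < max_dev q N x)%R] <= P A)%E.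
Proof.
move=> q0; set E := [set x | _]; have mE : measurable E by exact: mpos.
have mM : measurable_fun setT (fun x => (max_dev q N x)%:E).
  by apply/measurable_EFinP; exact: measurable_max_dev.
have mMt : measurable_fun setT (fun x => (max_dev q N (tau x))%:E).
  by apply/measurable_EFinP; apply: measurableT_comp => //;
    exact: measurable_max_dev.
have mI (B : set X) : measurable B ->
    measurable_fun setT (fun x : X => (\1_B x : R)%:E).
  by move=> mB; apply/measurable_EFinP; exact: measurable_indic.
have inv :
    (\int[P]_x (max_dev q N (tau x))%:E = \int[P]_x (max_dev q N x)%:E)%E.
  have -> : (\int[P]_x (max_dev q N x)%:E =
      \int[pushforward P tau]_x (max_dev q N x)%:E)%E.
    apply: eq_measure_integral => B mB _; rewrite /= /pushforward Ptau//.
  rewrite ge0_integral_pushforward//.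
  by move=> y _; rewrite lee_fin max_dev_ge0.
have fin : (\int[P]_x (max_dev q N x)%:E \is a fin_num)%E.
  rewrite ge0_fin_numE ?integral_ge0// => [|x _];
    last by rewrite lee_fin max_dev_ge0.
  apply: (@le_lt_trans _ _ (\int[P]_x (cst N%:R%:E x))%E).
    apply: ge0_le_integral => //.
    - by move=> x _; rewrite lee_fin max_dev_ge0.
    - by move=> x _; rewrite lee_fin max_dev_le.
  by rewrite integral_cst//= probability_setT mule1 ltry.
(* The pointwise inequality comes from the recursion on [E]; off [E] the left side is 0. After
   integration the two integrals of [max_dev] agree by invariance and cancel, being finite. *)
have : (\int[P]_x ((max_dev q N x)%:E + q%:E * (\1_E x)%:E) <=
        \int[P]_x ((\1_A x)%:E + (max_dev q N (tau x))%:E))%E.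
  apply: ge0_le_integral => //.
  - by move=> x _; rewrite -EFinM -EFinD lee_fin addr_ge0 ?max_dev_ge0//
      mulr_ge0.
  - apply: emeasurable_funD => //; apply: emeasurable_funM => //; exact: mI.
  - by apply: emeasurable_funD => //; exact: mI.
  move=> x _; rewrite -EFinM -!EFinD lee_fin.
  have A0 : 0 <= \1_A x :> R by rewrite indicE.
  rewrite [\1_E x]indicE; case: (boolP (x \in E)) => [|/negP].
    rewrite inE /E /= mulr1; case: (N) => [|M]; first by rewrite ltxx.
    rewrite [max_dev q M.+1 x]/= lt_max ltxx /= => h.
    rewrite max_r; last exact: ltW.
    rewrite [leRHS](_ : _ = \1_A x + max_dev q M.+1 (tau x))//.
    by have := max_devS q M (tau x); lra.
  rewrite inE /E /= => /negP; rewrite -leNgt => h.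
  by rewrite mulr0 addr0 (le_trans h)// addr_ge0// max_dev_ge0.
rewrite !ge0_integralD//; last 5 first.
- exact: mI.
- by move=> x _; rewrite lee_fin max_dev_ge0.
- by move=> x _; rewrite lee_fin max_dev_ge0.
- by move=> x _; rewrite -EFinM lee_fin mulr_ge0.
- by apply: emeasurable_funM => //; exact: mI.
rewrite inv ge0_integralZl//; last exact: mI.
by rewrite !integral_indic// !setIT addeC leeD2rE.
Qed.

Definition ergodic_map :=
  forall B, measurable B -> tau @^-1` B = B -> P B = 0%E \/ P B = 1%E.

Definition unbounded_dev (q : R) : set X :=
  \bigcap_K \bigcup_n [set x | K%:R < visits n x - q * n%:R].

Let mdev (q : R) (K n : nat) :
  measurable [set x | K%:R < visits n x - q * n%:R].
Proof.
rewrite (_ : [set x | _] = setT `&` visits n @^-1` `]K%:R + q * n%:R, +oo[).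
  by apply: measurable_visits => //; exact: measurable_itv.
by rewrite setTI; apply/seteqP; split => x /=; rewrite in_itv/= andbT ltrBrDr.
Qed.

Lemma measurable_unbounded_dev q : measurable (unbounded_dev q).
Proof.
by apply: bigcap_measurable => // K _; apply: bigcup_measurable => n _.
Qed.

(** Replacing [x] by [tau x] and shifting the index changes a deviation by at most 1 + |q|, which
    cannot affect unboundedness. Exact equality is needed because [ergodic_map] speaks of strictly
    invariant sets. *)
Lemma unbounded_dev_invariant q : tau @^-1` unbounded_dev q = unbounded_dev q.
Proof.
have I x : 0 <= (\1_A x : R) <= 1.
  by rewrite indicE; case: (_ \in _); rewrite ?lexx ?ler01.
have nat_gt (z : R) : exists K : nat, z < K%:R.
  by exists (Num.bound `|z|);
    exact: le_lt_trans (ler_norm z) (archi_boundP (normr_ge0 z)).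
apply/seteqP; split => x h K _.
  have [L Lq] := nat_gt (K%:R + `|q| + 1).
  have [n _ /= hn] := h L Logic.I.
  exists n.+1 => //=; rewrite visitsSl -natr1 mulrDr mulr1.
  by have /andP[] := I x; have := ler_norm q; lra.
have [L Lq] := nat_gt (K%:R + `|q| + 1).
(* Index 0 has no predecessor, but it cannot occur: the deviation there is 0, while [L] is
   positive. *)
have [[_|n _] /= hn] := h L Logic.I.
  move: hn; rewrite /visits big_ord0 mulr0 subr0 => hn.
  by have := ler0n R K; have := normr_ge0 q; lra.
exists n => //=; move: hn; rewrite visitsSl -natr1 mulrDr mulr1.
by have /andP[] := I x; have := ler_norm (- q); rewrite normrN; lra.
Qed.

(** Otherwise the event has probability 1 by ergodicity; then almost every orbit has a positive
    deviation at some time, the sets [E N] increase to full measure, and the maximal inequality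
    gives q <= P A in the limit. *)
Lemma ergodic_unbounded_dev q : ergodic_map -> (P A < q%:E)%E ->
  P (unbounded_dev q) = 0%E.
Proof.
move=> erg Aq.
have q0 : 0 < q by rewrite -lte_fin; exact: le_lt_trans Aq.
have [//|B1] := erg _ (measurable_unbounded_dev q) (unbounded_dev_invariant q).
exfalso; move: Aq; rewrite ltNge => /negP; apply.
pose E N := [set x | 0 < max_dev q N x].
have nE : nondecreasing_seq E.
  apply/nondecreasing_seqP => n; apply/subsetPset => x /=.
  by rewrite /E /= => /lt_le_trans; apply; exact: max_devS.
have mUE : measurable (\bigcup_n E n).
  by apply: bigcup_measurable => n _; exact: mpos.
have : (P (E n) @[n --> \oo] --> P (\bigcup_n E n))%E.
  by apply: nondecreasing_cvg_mu => // i; exact: mpos.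
have -> : P (\bigcup_n E n) = 1%E.
  apply/eqP; rewrite eq_le probability_le1//=.
  rewrite -B1; apply: le_measure; rewrite ?inE//;
    first exact: measurable_unbounded_dev.
  move=> x /(_ 0%N Logic.I) [n _ /= h]; exists n => //; rewrite /E /=.
  by apply: lt_le_trans h _; exact: visits_le_max_dev.
move=> /(cvgeZl (isT : q%:E \is a fin_num)); rewrite mule1 => h.
rewrite -(cvg_lim _ h)//; apply: lime_le.
  by apply/cvg_ex; eexists; exact: h.
by apply: nearW => n /=; apply: maximal_ergodic; exact: ltW.
Qed.

(* The upper half of Birkhoff's theorem for the indicator of A; the lower half
   is the same statement for the complement of A. *)
Lemma ae_visits_le : ergodic_map ->
  {ae P, forall x, forall e, 0 < e ->
    exists K : nat, forall n, visits n x <= (fine (P A) + e) * n%:R + K%:R}.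
Proof.
move=> erg.
have Pfin : P A \is a fin_num by exact: fin_num_measure.
(* Slopes P A + 1/(k+1) suffice for all e > 0 and cost only countably many null sets. *)
have : {ae P, forall x, forall k, ~ unbounded_dev (fine (P A) + k.+1%:R^-1) x}.
  apply: ae_foralln => k; exists (unbounded_dev (fine (P A) + k.+1%:R^-1));
    split.
  - exact: measurable_unbounded_dev.
  - apply: ergodic_unbounded_dev => //.
    by rewrite -[ltLHS]fineK// lte_fin ltrDl invr_gt0.
  - by move=> x /= /contrapT.
apply: filterS => x hx e e0.
have [k ke] : exists k : nat, k.+1%:R^-1 < e.
  exists (Num.bound e^-1); rewrite invf_plt ?posrE//.
  have := archi_boundP (ltW (_ : 0 < e^-1));
    rewrite invr_gt0 => /(_ e0) /lt_le_trans.
  by apply; rewrite ler_nat.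
have /existsNP[K /not_implyP[_ hK]] := hx k.
exists K => n; rewrite leNgt; apply/negP => hn; apply: hK; exists n => //=.
have : k.+1%:R^-1 * n%:R <= e * n%:R by rewrite ler_wpM2r// ltW.
move: hn; rewrite !mulrDl; move: (_^-1 * _) => z; lra.
Qed.
End visits.

(** * Transfer of the visit bound to the circle *)

Section circle_probability.
Variable R : realType.

Lemma measurable_circle : measurable (circle R : set (measurableTypeR R)).
Proof. exact: measurable_itv. Qed.

Definition circle_measure : set (measurableTypeR R) -> \bar R :=
  mrestr lebesgue_measure measurable_circle.

HB.instance Definition _ :=
  Measure.copy circle_measure (mrestr lebesgue_measure measurable_circle).

Lemma circle_measure_setT : circle_measure setT = 1%E.
Proof.
rewrite /circle_measure /mrestr setTI /circle.
by rewrite lebesgue_measure_itv/= lte_fin ltr01 oppr0 adde0.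
Qed.

HB.instance Definition _ :=
  Measure_isProbability.Build _ _ _ circle_measure circle_measure_setT.

Lemma iter_circle (tau : R -> R) k w : set_fun (circle R) (circle R) tau ->
  circle R w -> circle R (iter k tau w).
Proof. by move=> tc cw; elim: k => //= k; exact: tc. Qed.

Lemma ae_circle_visits_le (tau : R -> R) (A : set R) :
  ergodic tau -> measurable A -> A `<=` circle R ->
  {ae @lebesgue_measure R, forall w, circle R w -> forall e, 0 < e ->
    exists K : nat, forall n,
      visits R tau A n w <= (fine (lebesgue_measure A) + e) * n%:R + K%:R}.
Proof.
move=> [[tc mtau tP] erg] mA Ac.
(* Off the circle [tau] is arbitrary. Extending by the identity makes the map measurable on the
   whole line, and [circle_measure] does not see the change. *)
pose t x := if x \in circle R then tau x else x.
have mC : measurable (circle R) := measurable_circle.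
have tE B : circle R `&` t @^-1` B = circle R `&` tau @^-1` (B `&` circle R).
  apply/seteqP; split => x [cx] /=; rewrite /t mem_set//.
    by move=> Bx; split => //; split => //; exact: tc.
  by case.
have mt : measurable_fun setT t.
  move=> _ B mB; rewrite setTI.
  rewrite -(setUIDK (t @^-1` B) (circle R)) setIC tE.
  apply: measurableU; first by apply: mtau => //; exact: measurableI.
  rewrite (_ : _ `\` _ = B `\` circle R); first exact: measurableD.
  by apply/seteqP; split => x [] /= + cx; rewrite /t memNset.
have tP' B : measurable B -> circle_measure (t @^-1` B) = circle_measure B.
  move=> mB; rewrite /circle_measure /mrestr setIC tE tP//; exact: measurableI.
have terg : ergodic_map circle_measure t.
  move=> B mB tB; rewrite /circle_measure /mrestr; apply: erg.
  - exact: measurableI.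
  - exact: subIsetr.
  - by rewrite -tE tB setIC.
have [N [mN N0 hN]] := @ae_visits_le _ (measurableTypeR R) R circle_measure t A
  mt tP' mA terg.
(* A null set of [circle_measure] may have positive Lebesgue measure off the circle; only its trace
   on the circle is Lebesgue null. *)
exists (N `&` circle R); split => //; first exact: measurableI.
move=> w /= /not_implyP[cw hw]; split => //; apply: hN => /= h;
  apply: hw => e e0.
have [K hK] := h e e0; exists K => n; have := hK n.
rewrite /circle_measure /= /mrestr setIidl//; congr (_ <= _).
apply: eq_bigr => k _; congr (\1_A _).
elim: (k : nat) => //= j ->; rewrite /t mem_set//; exact: iter_circle.
Qed.

End circle_probability.

(** * Density of the kernels in the Hardy space *)

Section hardy_dot.
Variable R : realType.
Implicit Types (f g h : hardy R) (a u v w z : R[i]).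

Lemma hardy_norm_ge0 f : 0 <= hardy_norm f.
Proof. exact: sqrtr_ge0. Qed.

Lemma hardy_normD f g : hardy_norm (f + g) <= hardy_norm f + hardy_norm g.
Proof. by have := ler_normD f g; rewrite !hardy_normE -rmorphD /= lecR. Qed.

Lemma hardy_normZ a f : hardy_norm (a *: f) = normc a * hardy_norm f.
Proof.
have := normrZ a f; rewrite !hardy_normE.
have -> : `|a| = real_complex R (normc a) by [].
by rewrite -rmorphM /= => /complexI.
Qed.

Lemma hardy_normN f : hardy_norm (- f) = hardy_norm f.
Proof. by rewrite -scaleN1r hardy_normZ normcN normc1 mul1r. Qed.

Lemma hardy_norm0 : hardy_norm (0 : hardy R) = 0.
Proof. by rewrite -(scale0r 0) hardy_normZ normc0 mul0r. Qed.

Lemma hardy_norm_eq0 f : hardy_norm f = 0 -> f = 0.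
Proof. by move=> f0; apply: normr0_eq0; rewrite hardy_normE f0. Qed.

Lemma normc_conj z : normc (conjc z) = normc z.
Proof. by case: z => x y /=; rewrite sqrrN. Qed.

Lemma cvg_hardy_dot f g :
  series (fun n => taylor f n * conjc (taylor g n)) @ \oo --> hardy_dot f g.
Proof.
apply: complex_normed_cvg.
apply: (@series_le_cvg _ _
    (fun n => normc (taylor f n) ^+ 2 + normc (taylor g n) ^+ 2)) => [n|n|n|].
- exact: normc_ge0.
- by rewrite addr_ge0 ?sqr_ge0.
- rewrite normcM normc_conj.
  by have := sqr_ge0 (normc (taylor f n) - normc (taylor g n));
     have := sqr_ge0 (normc (taylor f n) + normc (taylor g n)); lra.
- rewrite (_ : series _ = sqsum (taylor f) \+ sqsum (taylor g)).
    by apply: is_cvgD; exact: cvg_sqsum_taylor.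
  by apply/funext => n; rewrite /sqsum /series /= big_split.
Qed.

Lemma hardy_dotPl a f g h :
  hardy_dot (a *: f + g) h = a * hardy_dot f h + hardy_dot g h.
Proof.
apply/cvg_lim => //.
rewrite (_ : series _ = fun n =>
    a * series (fun n => taylor f n * conjc (taylor h n)) n +
    series (fun n => taylor g n * conjc (taylor h n)) n).
  by apply: cvgD; [apply: cvgMl_tmp|]; exact: cvg_hardy_dot.
apply/funext => n; rewrite /series /= mulr_sumr -big_split /=.
by apply: eq_bigr => i _; rewrite mulrDl mulrA.
Qed.

Lemma hardy_dotPr a f g h :
  hardy_dot h (a *: f + g) = conjc a * hardy_dot h f + hardy_dot h g.
Proof.
apply/cvg_lim => //.
rewrite (_ : series _ = fun n =>
    conjc a * series (fun n => taylor h n * conjc (taylor f n)) n +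
    series (fun n => taylor h n * conjc (taylor g n)) n).
  by apply: cvgD; [apply: cvgMl_tmp|]; exact: cvg_hardy_dot.
apply/funext => n; rewrite /series /= mulr_sumr -big_split /=.
by apply: eq_bigr => i _; rewrite rmorphD rmorphM /= mulrDr mulrCA.
Qed.

Lemma hardy_dot0l h : hardy_dot 0 h = 0.
Proof.
have := hardy_dotPl 1 0 0 h; rewrite scaler0 addr0 mul1r.
by rewrite -[X in X = _]addr0 => /addrI /esym.
Qed.

Lemma hardy_dot0r h : hardy_dot h 0 = 0.
Proof.
have := hardy_dotPr 1 0 0 h; rewrite scaler0 addr0 conjc1 mul1r.
by rewrite -[X in X = _]addr0 => /addrI /esym.
Qed.

Lemma hardy_dotZl a f h : hardy_dot (a *: f) h = a * hardy_dot f h.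
Proof. by have := hardy_dotPl a f 0 h; rewrite hardy_dot0l !addr0. Qed.

Lemma hardy_dotZr a h f : hardy_dot h (a *: f) = conjc a * hardy_dot h f.
Proof. by have := hardy_dotPr a f 0 h; rewrite hardy_dot0r !addr0. Qed.

Lemma hardy_dot_suml n (x : nat -> R[i]) (F : nat -> hardy R) h :
  hardy_dot (\sum_(i < n) x i *: F i) h = \sum_(i < n) x i * hardy_dot (F i) h.
Proof.
elim: n => [|n ih]; first by rewrite !big_ord0 hardy_dot0l.
by rewrite !big_ord_recr /= addrC hardy_dotPl ih addrC.
Qed.

Lemma hardy_dot_sumr n (x : nat -> R[i]) (F : nat -> hardy R) h :
  hardy_dot h (\sum_(i < n) x i *: F i) =
  \sum_(i < n) conjc (x i) * hardy_dot h (F i).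
Proof.
elim: n => [|n ih]; first by rewrite !big_ord0 hardy_dot0r.
by rewrite !big_ord_recr /= addrC hardy_dotPr ih addrC.
Qed.

Lemma mulr_conjc z : z * conjc z = real_complex R (normc z ^+ 2).
Proof.
case: z => x y; rewrite /normc sqr_sqrtr ?addr_ge0 ?sqr_ge0//.
by rewrite /GRing.mul /= !expr2 mulrN opprK; congr Complex; ring.
Qed.

Lemma hardy_dot_norm f : hardy_dot f f = real_complex R (hardy_norm f ^+ 2).
Proof.
rewrite /hardy_norm sqr_sqrtr; last exact/sqsum_lim_ge0/cvg_sqsum_taylor.
apply/cvg_lim => //.
rewrite (_ : series _ = fun n => real_complex R (sqsum (taylor f) n)).
  by apply: cvg_complex => /=; [exact: cvg_sqsum_taylor|exact: cvg_cst].
apply/funext => n; rewrite /sqsum /series /= raddf_sum /=.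
by apply: eq_bigr => i _; rewrite mulr_conjc.
Qed.

Lemma hardy_dot_inj f g : (forall h, hardy_dot h f = hardy_dot h g) -> f = g.
Proof.
move=> fg; apply/eqP; rewrite -subr_eq0; apply/eqP/hardy_norm_eq0.
have : hardy_dot (f - g) (f - g) = 0.
  rewrite -[X in hardy_dot _ X]scale1r -[X in 1 *: X]opprB opprB addrC.
  by rewrite -scaleN1r scale1r hardy_dotPr fg rmorphN rmorph1 mulN1r addNr.
rewrite hardy_dot_norm => /(congr1 (@complex.Re R)) /= /eqP.
by rewrite sqrf_eq0 => /eqP.
Qed.

End hardy_dot.

(** The left side is the expanded inner product of two kernels multiplied by the same Blaschke
    factor, with [c] standing for the conjugate of [w] and [v] for the conjugate of the second
    parameter; the right side is the inner product of the kernels themselves. *)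
Lemma blaschke_identity (F : fieldType) (u v w c : F) :
  u - w != 0 -> v - c != 0 -> 1 - u * v != 0 -> 1 - u * c != 0 ->
  1 - w * v != 0 -> 1 - w * c != 0 ->
  (1 - c * u) / (u - w) * ((1 - w * v) / (v - c) / (1 - u * v) +
    (1 - w * c) / (c - v) / (1 - u * c)) +
  (1 - c * w) / (w - u) * ((1 - w * v) / (v - c) / (1 - w * v) +
    (1 - w * c) / (c - v) / (1 - w * c)) = (1 - u * v)^-1.
Proof.
move=> *; field.
by rewrite -[w - u]opprB -[c - v]opprB !oppr_eq0; do !(apply/andP; split).
Qed.

(* The reproducing kernel at conjc w; locked, as conversion problems on its
   unfolding blow up. *)
HB.lock Definition cauchy_kernel (R : realType) (w : R[i]) : hardy R :=
  insubd 0 (fun n => w ^+ n).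

(** * Reproducing kernels and Blaschke factors *)

Section kernels.
Variable R : realType.
Implicit Types (f g h : hardy R) (u v w z : R[i]).

Lemma unit_disk_conj z : unit_disk z -> unit_disk (conjc z).
Proof. by rewrite /unit_disk /= normc_conj. Qed.

Lemma geometric_square_summable w : unit_disk w ->
  (fun n => w ^+ n) \in @square_summable R.
Proof.
move=> w1; apply/square_summableP.
rewrite (_ : sqsum _ = series (geometric 1 (normc w ^+ 2))).
  apply: is_cvg_geometric_series; rewrite ger0_norm ?sqr_ge0//.
  by rewrite expr_lt1// normc_ge0.
rewrite /sqsum; congr series; apply/funext => n.
by rewrite normcX /= mul1r -!exprM mulnC.
Qed.

Lemma taylor_cauchy_kernel w : unit_disk w ->
  taylor (cauchy_kernel w) = fun n => w ^+ n.
Proof.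
move=> w1; rewrite cauchy_kernel.unlock; apply: insubdK.
exact: geometric_square_summable.
Qed.

Lemma hardy_dot_kernel f w : unit_disk w ->
  hardy_dot f (cauchy_kernel w) = f (conjc w).
Proof.
move=> w1; rewrite /hardy_dot /hardy_fun taylor_cauchy_kernel//.
by congr (limn (series _)); apply/funext => n; rewrite rmorphXn.
Qed.

Lemma unit_disk_mul_neq1 u v : unit_disk u -> unit_disk v -> 1 - u * v != 0.
Proof.
move=> u1 v1; rewrite subr_eq0; apply/eqP => /(congr1 (@normc R)).
rewrite normc1 normcM => e.
have : normc u * normc v < 1 * 1 by rewrite ltr_pM// normc_ge0.
by rewrite -e mulr1 ltxx.
Qed.

Lemma cauchy_kernelE u z : unit_disk u -> unit_disk z ->
  cauchy_kernel u z = (1 - u * z)^-1.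
Proof.
move=> u1 z1; set S := cauchy_kernel u z.
(* The shifted partial sums of the geometric series converge to both sides of this fixed-point
   equation, which determines [S]. *)
suff e : S = 1 + u * z * S.
  have nz := unit_disk_mul_neq1 u1 z1.
  by apply: (mulfI nz); rewrite divff// mulrBl mul1r {1}e addrK.
have cS : series (fun n => u ^+ n * z ^+ n) @ \oo --> S.
  by have := @hardy_cvg _ (cauchy_kernel u) z z1; rewrite taylor_cauchy_kernel.
have : series (fun n => u ^+ n * z ^+ n) @ \oo --> 1 + u * z * S.
  rewrite -cvg_shiftS /=.
  rewrite (_ : (fun n => _) = fun n =>
      1 + u * z * series (fun n => u ^+ n * z ^+ n) n); last first.
    apply/funext => n; rewrite /series /= big_nat_recl//= !expr0 mul1r
      mulr_sumr.
    by congr +%R; apply: eq_bigr => i _; rewrite !exprS mulrACA.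
  by apply: cvgD; [exact: cvg_cst|exact: cvgMl_tmp].
move=> /cvg_lim <-//.
by move: cS => /cvg_lim <-.
Qed.

Lemma dot_kernels u v : unit_disk u -> unit_disk v ->
  hardy_dot (cauchy_kernel u) (cauchy_kernel v) = (1 - u * conjc v)^-1.
Proof.
by move=> u1 v1; rewrite hardy_dot_kernel// cauchy_kernelE//;
  exact: unit_disk_conj.
Qed.

(* Partial fractions: blaschke_kernel w u is the product of z |-> 1 / (1 - u z)
   with the Blaschke factor z |-> (z - conjc w) / (1 - w z), whose modulus on
   the unit circle is 1. *)
Definition blaschke_kernel w u : hardy R :=
  ((1 - conjc w * u) / (u - w)) *: cauchy_kernel u +
  ((1 - conjc w * w) / (w - u)) *: cauchy_kernel w.

(** Multiplication by an inner function is isometric. Between kernels this is a rational identity,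
    so no boundary values enter. *)
Lemma dot_blaschke_kernels w u v :
  unit_disk w -> unit_disk u -> unit_disk v -> u != w -> v != w ->
  hardy_dot (blaschke_kernel w u) (blaschke_kernel w v) =
  hardy_dot (cauchy_kernel u) (cauchy_kernel v).
Proof.
move=> w1 u1 v1 uw vw.
have cu := unit_disk_conj u1; have cv := unit_disk_conj v1.
have cw := unit_disk_conj w1.
rewrite /blaschke_kernel.
have := dot_kernels w1 w1; have := dot_kernels w1 v1.
have := dot_kernels u1 w1; have := dot_kernels u1 v1.
move: (cauchy_kernel u) (cauchy_kernel v) (cauchy_kernel w) => Ku Kv Kw.
move=> uvE uwE wvE wwE.
rewrite hardy_dotPl hardy_dotZl !hardy_dotPr !hardy_dotZr uvE uwE wvE wwE.
rewrite !(rmorphM, rmorphB, fmorphV, rmorph1) /= conjcK.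
apply: blaschke_identity.
- by rewrite subr_eq0.
- by rewrite -rmorphB conjc_eq0 subr_eq0.
all: exact: unit_disk_mul_neq1.
Qed.
End kernels.

(** * From the kernels of a small ball to all kernels *)

Section density.
Variable R : realType.
Implicit Types (f g h : hardy R) (u v w z : R[i]).
Local Notation K := (@cauchy_kernel R).

(** This is the identity that makes a Blaschke factor less than 1 in modulus inside the disk; the
    last product measures the gap. *)
Lemma normc_gram w v : normc (1 - conjc w * v) ^+ 2 =
  normc (v - w) ^+ 2 + (1 - normc w ^+ 2) * (1 - normc v ^+ 2).
Proof.
case: w v => [a b] [c d].
rewrite /normc /= !sqr_sqrtr ?addr_ge0 ?sqr_ge0//; ring.
Qed.

(** The combination is K (u 0) times n Blaschke factors, up to conjugating the parameters. Partial
    fractions keep it in the span of the kernels, each factor preserves the norm, and the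
    coefficient of K (u 0) is divided by the value of the factor, hence grows. *)
Lemma blaschke_combination (u : nat -> R[i]) n :
  (forall i, unit_disk (u i)) -> injective u ->
  exists x : nat -> R[i],
    x 0%N = \prod_(j < n) ((1 - conjc (u j.+1) * u 0%N) / (u 0%N - u j.+1)) /\
    hardy_norm (\sum_(j < n.+1) x j *: K (u j)) = hardy_norm (K (u 0%N)).
Proof.
move=> u1 uI; elim: n => [|n [x [x0 xn]]].
  by exists (fun=> 1); rewrite big_ord0 big_ord_recl big_ord0 scale1r addr0.
pose w := u n.+1.
pose al j := (1 - conjc w * u j) / (u j - w).
pose be j := (1 - conjc w * w) / (w - u j).
(* Each old kernel contributes its own multiple and a multiple of the new kernel [K w]; index n + 1
   collects the latter. *)
pose y j := if (j < n.+1)%N then x j * al j else \sum_(j < n.+1) x j * be j.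
exists y; split; first by rewrite big_ord_recr /= -x0 /y.
have ne (j : 'I_n.+1) : u j != w.
  by apply: contraTneq (ltn_ord j) => /uI ->; rewrite ltnn.
have -> : \sum_(j < n.+2) y j *: K (u j) =
    \sum_(j < n.+1) x j *: blaschke_kernel w (u j).
  rewrite big_ord_recr /= {2}/y ltnn scaler_suml -big_split /=.
  apply: eq_bigr => j _.
  rewrite /y ltn_ord /blaschke_kernel -/(al j) -/(be j).
  by rewrite [RHS]scalerDr !scalerA.
rewrite -xn; apply/eqP; rewrite -(@eqrXn2 _ 2) ?hardy_norm_ge0//; apply/eqP.
apply: (@complexI R); rewrite -!hardy_dot_norm.
rewrite (hardy_dot_suml _ x (fun j => blaschke_kernel w (u j))).
rewrite (hardy_dot_suml _ x (fun j => K (u j))).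
apply: eq_bigr => i _; congr (_ * _).
rewrite (hardy_dot_sumr _ x (fun j => blaschke_kernel w (u j))).
rewrite (hardy_dot_sumr _ x (fun j => K (u j))).
by apply: eq_bigr => j _; congr (_ * _); apply: dot_blaschke_kernels => //;
  exact: u1.
Qed.

Definition linear_subspace (P : set (hardy R)) :=
  P 0 /\ forall a f g, P f -> P g -> P (a *: f + g).

Definition approximable (P : set (hardy R)) : set (hardy R) :=
  [set f | forall e : R, 0 < e -> exists2 g, P g & hardy_norm (f - g) < e].

Lemma sub_approx P : P `<=` approximable P.
Proof. by move=> f Pf e e0; exists f => //; rewrite subrr hardy_norm0. Qed.

Lemma subspace_sum P n (x : nat -> R[i]) (F : nat -> hardy R) :
  linear_subspace P ->
  (forall i, P (F i)) -> P (\sum_(i < n) x i *: F i).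
Proof.
move=> [P0 PD] PF; elim: n => [|n ih]; first by rewrite big_ord0.
by rewrite big_ord_recr /= addrC; exact: PD.
Qed.

Lemma subspaceZ P a f : linear_subspace P -> P f -> P (a *: f).
Proof. by move=> [P0 PD] Pf; rewrite -[_ *: _]addr0; exact: PD. Qed.

Lemma subspace_approx P : linear_subspace P -> linear_subspace (approximable P).
Proof.
move=> [P0 PD]; split; first exact: sub_approx.
move=> a f g Pf Pg e e0.
have e2 : 0 < e / 2 by rewrite divr_gt0.
have a1 : 0 < normc a + 1 by rewrite ltr_wpDl// normc_ge0.
have [f' Pf' ff'] := Pf (e / 2 / (normc a + 1)) (divr_gt0 e2 a1).
have [g' Pg' gg'] := Pg _ e2.
exists (a *: f' + g'); first exact: PD.
rewrite opprD addrACA -scalerBr; apply: le_lt_trans (hardy_normD _ _) _.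
rewrite hardy_normZ [e]splitr ler_ltD//.
move: ff'; rewrite ltr_pdivlMr// => /ltW; apply: le_trans.
by rewrite mulrC ler_wpM2l ?hardy_norm_ge0// lerDl.
Qed.

Lemma approx_approx P : approximable (approximable P) `<=` approximable P.
Proof.
move=> f Pf e e0; have e2 : 0 < e / 2 by rewrite divr_gt0.
have [g Pg fg] := Pf _ e2; have [h Ph gh] := Pg _ e2.
exists h => //; rewrite -(subrK g f) -addrA.
by apply: le_lt_trans (hardy_normD _ _) _; rewrite [e]splitr ltrD.
Qed.

Lemma geometric_small (q c e : R) : 0 <= q < 1 -> 0 < e ->
  exists n, q ^+ n * c < e.
Proof.
move=> /andP[q0 q1] e0.
have : q ^+ n * c @[n --> \oo] --> 0 * c.
  by apply: cvgMr_tmp; apply: cvg_expr; rewrite ger0_norm.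
rewrite mul0r => /cvgrPdist_lt /(_ _ e0) [n _ /(_ n (leqnn n))] /=.
by rewrite sub0r normrN => /(le_lt_trans (ler_norm _)); exists n.
Qed.

(* By blaschke_combination, the distance from K v to the span of n kernels in
   the ball is at most the modulus at v of a product of n Blaschke factors. *)
Lemma kernel_approx_ball P w0 (r : R) v :
  linear_subspace P -> unit_disk w0 -> 0 < r ->
  (forall w, unit_disk w -> normc (w - w0) < r -> P (K w)) ->
  unit_disk v -> approximable P (K v).
Proof.
move=> sP w01 r0 PK v1.
(* If [K v] is not already in [P], then [v] differs from every point of the ball used below, which
   gives injectivity of [u] and nonzero denominators. *)
have [/sub_approx//|nPv] := pselect (P (K v)).
pose s := (normc w0 + 1) / 2.
pose t := Num.min (r / 2) ((1 - normc w0) / 2).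
have w01' : normc w0 < 1 := w01.
have t0 : 0 < t by rewrite lt_min !divr_gt0// subr_gt0.
have tr : t <= r / 2 by rewrite ge_min lexx.
have ts : t <= (1 - normc w0) / 2 by rewrite ge_min lexx orbT.
(* Infinitely many distinct points of the ball; the choice of [t] also keeps them in the closed disk
   of radius s < 1, so that the bound on the Blaschke factors is uniform in [j]. *)
pose p j := w0 + real_complex R (t / j.+1%:R).
have pt j : normc (real_complex R (t / j.+1%:R)) <= t.
  rewrite /= expr0n addr0 sqrtr_sqr ger0_norm ?divr_ge0//; last exact: ltW.
  by rewrite ler_pdivrMr// ler_peMr ?ler1n//; exact: ltW.
have ps j : normc (p j) <= s.
  by apply: le_trans (le_normcD _ _) _; have := pt j; rewrite /s; lra.
have s1 : s < 1 by rewrite /s; lra.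
have s0 : 0 <= s by have := normc_ge0 w0; rewrite /s; lra.
have p1 j : unit_disk (p j) by exact: le_lt_trans (ps j) s1.
have Pp j : P (K (p j)).
  apply: PK => //; rewrite /p addrAC subrr add0r.
  by apply: le_lt_trans (pt j) _; lra.
pose u j := if j is i.+1 then p i else v.
have u1 j : unit_disk (u j) by case: j => /=.
have pI : injective p.
  move=> i j /addrI /complexI /(mulfI (lt0r_neq0 t0)) /invr_inj /eqP.
  by rewrite eqr_nat eqSS => /eqP.
have uI : injective u.
  move=> [|i] [|j]//=; last by move=> /pI ->.
  - by move=> e; exfalso; apply: nPv; rewrite e.
  - by move=> e; exfalso; apply: nPv; rewrite -e.
pose d := (1 - s ^+ 2) * (1 - normc v ^+ 2).
have v0 := normc_ge0 v; have v1' : normc v < 1 := v1.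
have s2 : 0 < 1 - s ^+ 2 by rewrite subr_gt0 expr_lt1.
have v2 : 0 < 1 - normc v ^+ 2 by rewrite subr_gt0 expr_lt1.
have d0 : 0 < d by rewrite mulr_gt0.
have d1 : d <= 1.
  by rewrite /d -[leRHS]mul1r; apply: ler_pM; rewrite ?gerBl ?sqr_ge0// ltW.
(* By [normc_gram] the squared modulus of a Blaschke factor is 1 minus a quotient whose numerator is
   at least [d] and whose denominator is at most 2 ^ 2 = 4. *)
pose q := Num.sqrt (1 - d / 4).
have q0 : 0 <= q by exact: sqrtr_ge0.
have q2 : q ^+ 2 = 1 - d / 4 by rewrite sqr_sqrtr//; lra.
have q1 : q < 1 by rewrite -(@ltr_pXn2r _ 2)// ?nnegrE// q2 expr1n; lra.
have dn j : 1 - conjc (p j) * v != 0.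
  by apply: unit_disk_mul_neq1 => //; exact: unit_disk_conj.
have vp j : v - p j != 0.
  by rewrite subr_eq0; apply/eqP => e; apply: nPv; rewrite e.
have ratio j : normc ((1 - conjc (p j) * v) / (v - p j))^-1 <= q.
  rewrite invfM invrK mulrC normcM normcV.
  have D0 : 0 < normc (1 - conjc (p j) * v).
    by rewrite lt_def normc_ge0 andbT; apply: contra (dn j) => /eqP/eq0_normc->.
  have D2 : normc (1 - conjc (p j) * v) <= 2.
    apply: le_trans (le_normcD _ _) _; rewrite normcN normc1 normcM normc_conj.
    have : normc (p j) * normc v <= 1 * 1.
      by rewrite ler_pM ?normc_ge0// ltW//; exact: p1.
    by lra.
  rewrite ler_pdivrMr// -(@ler_pXn2r _ 2)// ?nnegrE ?mulr_ge0 ?normc_ge0//.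
  rewrite exprMn q2.
  have G := normc_gram (p j) v.
  have : d <= (1 - normc (p j) ^+ 2) * (1 - normc v ^+ 2).
    rewrite /d ler_wpM2r//; first exact: ltW.
    by rewrite lerD2l lerN2 lerXn2r ?nnegrE ?normc_ge0.
  have : normc (1 - conjc (p j) * v) ^+ 2 <= 4.
    by have := ler_pM (ltW D0) (ltW D0) D2 D2; rewrite -expr2; lra.
  move: G; set X := _ ^+ 2; set Y := _ ^+ 2; set Z := (_ * _) => -> h1 h2.
  have : d / 4 * (Y + Z) <= d / 4 * 4 by rewrite ler_wpM2l// divr_ge0// ltW.
  by lra.
move=> e e0.
have [n hn] := geometric_small (hardy_norm (K v)) (introT andP (conj q0 q1)) e0.
have [x [x0 xn]] := blaschke_combination n u1 uI.
have xN : x 0%N != 0.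
  by rewrite x0; apply/prodf_neq0 => /= j _; rewrite mulf_neq0 ?invr_neq0.
have nx : normc (x 0%N)^-1 <= q ^+ n.
  rewrite x0; elim: (n) => [|m ih]; first by rewrite big_ord0 invr1 normc1.
  rewrite big_ord_recr /= [(_ * (_ / _))^-1]invfM normcM exprSr.
  by rewrite ler_pM ?normc_ge0//; exact: ratio.
(* Normalizing the coefficient of [K v] to 1 cancels [K v] here, so only kernels at the points [p j]
   remain; the error has norm |x 0|^-1 times that of [K v]. *)
exists (K v - (x 0%N)^-1 *: \sum_(j < n.+1) x j *: K (u j)); last first.
  rewrite opprB addrC subrK hardy_normZ xn /=.
  by apply: le_lt_trans hn; rewrite ler_wpM2r// hardy_norm_ge0.
rewrite big_ord_recl /= scalerDr scalerA mulVf// scale1r opprD addrA.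
rewrite subrr add0r.
rewrite -scaleNr; apply: subspaceZ => //.
exact: (@subspace_sum P n (fun j => x j.+1) (fun j => K (p j)) sP Pp).
Qed.
End density.

(** * From kernels to monomials and to the whole space *)

Section totality.
Variable R : realType.
Implicit Types (f g h : hardy R) (u v w z : R[i]).
Local Notation K := (@cauchy_kernel R).

Definition shift_seq (a : nat -> R[i]) n := if n is m.+1 then a m else 0.

Lemma sqsum_shift a n : sqsum (shift_seq a) n.+1 = sqsum a n.
Proof.
rewrite /sqsum /series /= big_nat_recl//= expr0n addr0 sqrtr0 expr0n /=.
by rewrite add0r.
Qed.

Lemma shift_square_summable a : a \in @square_summable R ->
  shift_seq a \in @square_summable R.
Proof.
move=> /square_summableP ca; apply/square_summableP.
apply: (@sqsum_bounded _ _ (limn (sqsum a))) => -[|n].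
  by rewrite {1}/sqsum /series /= big_geq//; exact: sqsum_lim_ge0.
by rewrite sqsum_shift; exact: sqsum_le_lim.
Qed.

Definition hardy_shift f : hardy R :=
  Hardy (shift_square_summable (valP f)).

Lemma hardy_shift_norm f : hardy_norm (hardy_shift f) = hardy_norm f.
Proof.
congr Num.sqrt; apply/cvg_lim => //; rewrite -cvg_shiftS /=.
rewrite (_ : (fun n => _) = sqsum (taylor f)); first exact: cvg_sqsum_taylor.
by apply/funext => n; exact: sqsum_shift.
Qed.

Lemma hardy_shiftP a f g :
  hardy_shift (a *: f + g) = a *: hardy_shift f + hardy_shift g.
Proof.
by apply/val_inj/funext => -[|n]//=; rewrite -[RHS]/(a * 0 + 0) mulr0 addr0.
Qed.

Lemma iter_hardy_shiftP n a f g : iter n hardy_shift (a *: f + g) =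
  a *: iter n hardy_shift f + iter n hardy_shift g.
Proof. by elim: n => //= n ->; exact: hardy_shiftP. Qed.

Lemma iter_hardy_shift_norm n f :
  hardy_norm (iter n hardy_shift f) = hardy_norm f.
Proof. by elim: n => //= n; rewrite hardy_shift_norm. Qed.

Lemma unit_disk0 : @unit_disk R 0.
Proof. by rewrite /unit_disk /= expr0n addr0 sqrtr0. Qed.

Lemma cauchy_kernel_shift w : unit_disk w ->
  K w = w *: hardy_shift (K w) + K 0.
Proof.
move=> w1; apply/val_inj/funext => n.
rewrite [LHS](_ : _ = w ^+ n); last by rewrite /= taylor_cauchy_kernel.
rewrite [RHS](_ : _ = w * shift_seq (taylor (K w)) n + taylor (K 0) n)//.
rewrite !taylor_cauchy_kernel//; last exact: unit_disk0.
case: n => [|n] /=; first by rewrite !expr0 mulr0 add0r.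
by rewrite expr0n addr0 exprS.
Qed.

(** [K 0] is the constant function 1 because 0 ^ 0 = 1, so its iterated shifts are the monomials. *)
Lemma taylor_iter_shift n k :
  taylor (iter n hardy_shift (K 0)) k = (k == n)%:R.
Proof.
elim: n k => [|n ih] [|k] //=; rewrite ?ih//.
- by rewrite taylor_cauchy_kernel//; exact: unit_disk0.
- by rewrite taylor_cauchy_kernel ?expr0n//; exact: unit_disk0.
Qed.

(** The squared norm is 1 / (1 - |w|^2) <= 4/3. Any uniform bound near 0 would serve the limit w ->
    0 in [approx_iter_shift]. *)
Lemma hardy_norm_kernel w : normc w <= 2^-1 -> hardy_norm (K w) <= 2.
Proof.
move=> w2; have w1 : unit_disk w.
  by apply: le_lt_trans w2 _; rewrite invf_lt1// ltr1n.
have : hardy_norm (K w) ^+ 2 * (1 - normc w ^+ 2) = 1.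
  apply: (@complexI R); rewrite rmorphM /= -hardy_dot_norm dot_kernels//.
  rewrite rmorphB rmorph1 /= -mulr_conjc mulVf//.
  by apply: unit_disk_mul_neq1 => //; exact: unit_disk_conj.
have n0 := normc_ge0 w.
have w4 : normc w ^+ 2 <= 4^-1.
  by have := ler_pM n0 n0 w2 w2; rewrite -expr2 -invfM -natrM.
have := sqr_ge0 (hardy_norm (K w)); set X := _ ^+ 2 => X0 e.
rewrite -(@ler_pXn2r _ 2)// ?nnegrE ?hardy_norm_ge0// -/X expr2.
have : X * (1 - 4^-1) <= 1 by rewrite -[leRHS]e ler_wpM2l// lerD2l lerN2.
by lra.
Qed.

(* Induction on n by K w = K 0 + w *: hardy_shift (K w), dividing by w if
   w != 0 and letting w -> 0 otherwise. *)
Lemma approx_iter_shift P n w : linear_subspace P ->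
  (forall w, unit_disk w -> approximable P (K w)) -> unit_disk w ->
  approximable P (iter n hardy_shift (K w)).
Proof.
move=> sP PK; have sA := subspace_approx sP; elim: n w => [|n ih] w w1.
  exact: PK.
have ne0 v : unit_disk v -> v != 0 ->
    approximable P (iter n.+1 hardy_shift (K v)).
  move=> v1 v0.
  have e : v *: iter n.+1 hardy_shift (K v) =
      - 1 *: iter n hardy_shift (K 0) + iter n hardy_shift (K v).
    rewrite [X in _ + iter _ _ X](cauchy_kernel_shift v1) iter_hardy_shiftP.
    by rewrite iterSr addrC -addrA scaleN1r subrr addr0.
  rewrite -[iter _ _ _]scale1r -(mulVf v0) -scalerA e.
  apply: (subspaceZ _ sA); apply: (sA.2); apply: ih => //.
  exact: unit_disk0.
have [->|/ne0] := eqVneq w 0; last by apply.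
apply: approx_approx => e e0.
(* The error below is t times the norm of a kernel, which is at most 2, hence at most e / 2. *)
pose t := Num.min 2^-1 (e / 4).
have t0 : 0 < t by rewrite lt_min invr_gt0 ltr0n divr_gt0.
have t2 : t <= 2^-1 by rewrite ge_min lexx.
have te : t <= e / 4 by rewrite ge_min lexx orbT.
pose v := real_complex R t.
have nv : normc v = t by rewrite /v /= expr0n addr0 sqrtr_sqr gtr0_norm.
have v1 : unit_disk v.
  by rewrite /unit_disk /mkset nv (le_lt_trans t2)// invf_lt1// ltr1n.
exists (iter n.+1 hardy_shift (K v)).
  apply: ne0 => //; apply: contraTneq t0 => v0.
  by rewrite -nv v0 normc0 ltxx.
have -> : iter n.+1 hardy_shift (K 0) - iter n.+1 hardy_shift (K v) =
    - v *: iter n.+2 hardy_shift (K v).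
  rewrite [X in _ - iter _ _ X](cauchy_kernel_shift v1) iter_hardy_shiftP.
  by rewrite [iter n.+2 _ _]iterSr opprD addrCA subrr addr0 scaleNr.
rewrite hardy_normZ normcN nv iter_hardy_shift_norm.
have : t * hardy_norm (K v) <= t * 2.
  by rewrite ler_wpM2l ?(ltW t0)// hardy_norm_kernel// nv.
by lra.
Qed.

Lemma hardy_truncation f (e : R) : 0 < e -> exists n,
  hardy_norm (f - \sum_(k < n) taylor f k *: iter k hardy_shift (K 0)) < e.
Proof.
move=> e0; set L := limn (sqsum (taylor f)).
have e2 : 0 < e ^+ 2 by rewrite exprn_gt0.
have /cvgrPdist_lt /(_ _ e2) [n _ /(_ n (leqnn n)) /= hn] :=
  @cvg_sqsum_taylor _ f.
exists n; set g := _ - _.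
have gE k : taylor g k = if (k < n)%N then 0 else taylor f k.
  rewrite /g.
  have -> : taylor (f - \sum_(k < n) taylor f k *: iter k hardy_shift (K 0)) k =
      taylor f k - \sum_(j < n) taylor f j * (k == j)%:R.
    rewrite -[LHS]/(taylor f k - taylor (\sum_(j < n) _) k); congr (_ - _).
    elim: (n) => [|m ih]; first by rewrite !big_ord0.
    by rewrite !big_ord_recr /= -ih -taylor_iter_shift.
  case: ltnP => kn.
    rewrite (bigD1 (Ordinal kn))//= eqxx mulr1 big1 ?addr0 ?subrr// => j jk.
    by rewrite (_ : (k == j) = false) ?mulr0//;
      apply: contra_neqF jk => /eqP kj;
       exact/val_inj.
  rewrite big1 ?subr0// => j _; rewrite (_ : (k == j) = false) ?mulr0//.
  by apply/eqP => kj; have := ltn_ord j; rewrite -kj ltnNge kn.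
(* The tail of the squared coefficients of [f]; [minn] covers N <= n, where both sides vanish. *)
have gN N :
    sqsum (taylor g) N <= sqsum (taylor f) N - sqsum (taylor f) (minn N n).
  elim: N => [|N ih]; first by rewrite min0n subrr /sqsum /series /= big_geq.
  rewrite !sqsumS gE; case: ltnP => Nn.
    rewrite (minn_idPl Nn) sqsumS subrr normc0 expr0n addr0.
    by apply: le_trans ih _; rewrite (minn_idPl (ltnW Nn)) subrr.
  rewrite (minn_idPr (leqW Nn)) addrAC lerD2r.
  by move: ih; rewrite (minn_idPr Nn).
rewrite -(@ltr_pXn2r _ 2)// ?nnegrE ?hardy_norm_ge0 ?(ltW e0)//.
rewrite /hardy_norm sqr_sqrtr; last exact/sqsum_lim_ge0/cvg_sqsum_taylor.
apply: le_lt_trans (le_lt_trans (ler_norm _) hn).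
apply: limr_le; first exact: cvg_sqsum_taylor.
apply: nearW => N; apply: le_trans (gN N) _.
have cf := @cvg_sqsum_taylor _ f.
have [Nn|nN] := leqP N n; first by rewrite subrr subr_ge0; exact: sqsum_le_lim.
by rewrite lerD2r; exact: sqsum_le_lim.
Qed.

Lemma kernels_total P w0 (r : R) f :
  linear_subspace P -> unit_disk w0 -> 0 < r ->
  (forall w, unit_disk w -> normc (w - w0) < r -> P (K w)) -> approximable P f.
Proof.
move=> sP w01 r0 PK.
have PK' w : unit_disk w -> approximable P (K w).
  by move=> w1; exact: kernel_approx_ball w01 r0 PK w1.
apply: approx_approx => e e0; have [n hn] := hardy_truncation f e0.
eexists; last exact: hn.
apply: (@subspace_sum _ _ n (taylor f) (fun k => iter k hardy_shift (K 0))).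
  exact: subspace_approx.
by move=> k; apply: approx_iter_shift => //; exact: unit_disk0.
Qed.
End totality.

(** * Mixing *)

Section mixing.
Variable R : realType.
Implicit Types (f g h : hardy R) (u v w z : R[i]).
Local Notation K := (@cauchy_kernel R).

(** [is_adjoint] does not ask for linearity of [S]; nondegeneracy of the inner product forces it. *)
Lemma adjoint_linear (M S : hardy R -> hardy R) : is_adjoint M S ->
  forall a f g, S (a *: f + g) = a *: S f + S g.
Proof.
move=> MS a f g; apply: hardy_dot_inj => h.
by rewrite -MS !hardy_dotPr !MS.
Qed.

(** Pairing with any [h] gives the value of phi h at [conjc w], that is, phi (conjc w) times the
    pairing of [h] with [K w]; conjugate linearity in the second argument puts the outer
    conjugate. *)
Lemma adjoint_kernel (phi : R[i] -> R[i]) (S : hardy R -> hardy R) w :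
  is_mul_op_adjoint phi S -> unit_disk w ->
  S (K w) = conjc (phi (conjc w)) *: K w.
Proof.
move=> [M MM MS] w1; apply: hardy_dot_inj => h.
rewrite -MS hardy_dot_kernel// MM; last exact: unit_disk_conj.
by rewrite hardy_dotZr conjcK hardy_dot_kernel.
Qed.

Lemma hardy_open_ball (U : set (hardy R)) f : open U -> U f ->
  exists2 e : R, 0 < e & forall g, hardy_norm (f - g) < e -> U g.
Proof.
move=> oU Uf; have /nbhs_normP[[e i]] : nbhs f U by exact: open_nbhs_nbhs.
rewrite /= ltcE /= => /andP[/eqP -> e0] eU; exists e => // g ge.
apply: eU; rewrite /ball_ /= hardy_normE.
by rewrite (_ : Complex e 0 = real_complex R e)// ltcR.
Qed.

Lemma cvg_norm_subspace (S : nat -> hardy R -> hardy R) :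
  (forall n a f g, S n (a *: f + g) = a *: S n f + S n g) ->
  linear_subspace [set f | hardy_norm (S n f) @[n --> \oo] --> (0 : R)].
Proof.
move=> linS; have S0 n : S n 0 = 0.
  have := linS n 1 0 0; rewrite scaler0 addr0 scale1r.
  by rewrite -[X in X = _]addr0 => /addrI /esym.
split=> /= [|a f g Sf Sg].
  by under eq_fun do rewrite S0 hardy_norm0; exact: cvg_cst.
apply: (@squeeze_cvgr _ _ _ _ (cst 0)
  (fun n => normc a * hardy_norm (S n f) + hardy_norm (S n g))).
- apply: nearW => n /=; rewrite hardy_norm_ge0 /= linS.
  by apply: le_trans (hardy_normD _ _) _; rewrite hardy_normZ.
- exact: cvg_cst.
- rewrite -[X in _ --> X]addr0 -[X in _ --> X + _](mulr0 (normc a)).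
  by apply: cvgD => //; exact: cvgMl_tmp.
Qed.

Lemma kernels_mixing (S : nat -> hardy R -> hardy R) (c : nat -> R[i] -> R[i])
    w1 w2 (r1 r2 : R) :
  (forall n a f g, S n (a *: f + g) = a *: S n f + S n g) ->
  (forall n w, unit_disk w -> S n (K w) = c n w *: K w) ->
  unit_disk w1 -> 0 < r1 ->
  (forall w, unit_disk w -> normc (w - w1) < r1 ->
    normc (c n w) @[n --> \oo] --> (0 : R)) ->
  unit_disk w2 -> 0 < r2 ->
  (forall w, unit_disk w -> normc (w - w2) < r2 ->
    (forall n, c n w != 0) /\ normc (c n w)^-1 @[n --> \oo] --> (0 : R)) ->
  topologically_mixing S.
Proof.
move=> linS eigS w11 r10 c1 w21 r20 c2.
pose X0 := [set f | hardy_norm (S n f) @[n --> \oo] --> (0 : R)].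
(* Preimages are chosen vector by vector. This makes [Y0] a subspace at once, with no linear right
   inverse of [S n] and hence no linear independence of kernels. *)
pose Y0 := [set f | exists2 s : nat -> hardy R,
  (forall n, S n (s n) = f) & hardy_norm (s n) @[n --> \oo] --> (0 : R)].
have sX : linear_subspace X0 by exact: cvg_norm_subspace.
have sY : linear_subspace Y0.
  split=> /= [|a f g [s sf s0] [t tg t0]].
    exists (fun=> 0); last by under eq_fun do rewrite hardy_norm0;
      exact: cvg_cst.
    move=> n; have := linS n 1 0 0; rewrite scaler0 addr0 scale1r.
    by rewrite -[X in X = _]addr0 => /addrI /esym.
  exists (fun n => a *: s n + t n) => [n|]; first by rewrite linS sf tg.
  apply: (@squeeze_cvgr _ _ _ _ (cst 0)
    (fun n => normc a * hardy_norm (s n) + hardy_norm (t n))).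
  - apply: nearW => n /=; rewrite hardy_norm_ge0 /=.
    by apply: le_trans (hardy_normD _ _) _; rewrite hardy_normZ.
  - exact: cvg_cst.
  - rewrite -[X in _ --> X]addr0 -[X in _ --> X + _](mulr0 (normc a)).
    by apply: cvgD => //; exact: cvgMl_tmp.
have KX w : unit_disk w -> normc (w - w1) < r1 -> X0 (K w).
  move=> wd ww; rewrite /X0 /mkset.
  under eq_fun do rewrite eigS// hardy_normZ.
  have := cvgMr_tmp (b := hardy_norm (K w)) (c1 w wd ww).
  by rewrite mul0r => /(_ _); exact.
have KY w : unit_disk w -> normc (w - w2) < r2 -> Y0 (K w).
  move=> wd ww; have [cN c0] := c2 w wd ww.
  exists (fun n => (c n w)^-1 *: K w) => [n|].
    rewrite -[X in S n X]addr0 linS eigS// scalerA mulVf// scale1r.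
    by rewrite -[RHS]addr0; congr +%R; have := linS n 1 0 0;
       rewrite scaler0 addr0 scale1r -[X in X = _]addr0 => /addrI /esym.
  under eq_fun do rewrite hardy_normZ.
  have := cvgMr_tmp (b := hardy_norm (K w)) c0.
  by rewrite mul0r => /(_ _); exact.
move=> U V oU oV [x Ux] [y Vy].
have [e e0 eU] := hardy_open_ball oU Ux;
  have [d d0 dV] := hardy_open_ball oV Vy.
have e2 : 0 < e / 2 by rewrite divr_gt0.
have d2 : 0 < d / 2 by rewrite divr_gt0.
have [x' Xx' xx'] := kernels_total x sX w11 r10 KX e2.
have [y' [s sy s0] yy'] := kernels_total y sY w21 r20 KY d2.
move/cvgrPdist_lt : s0 => /(_ _ e2) s0.
move/cvgrPdist_lt : Xx' => /(_ _ d2) Sx.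
near=> n.
have sn : hardy_norm (s n) < e / 2.
  apply: le_lt_trans (ler_norm _) _; rewrite -normrN -sub0r; near: n; exact: s0.
have Sn : hardy_norm (S n x') < d / 2.
  apply: le_lt_trans (ler_norm _) _; rewrite -normrN -sub0r; near: n; exact: Sx.
exists (S n (1 *: x' + s n)); split.
  exists (1 *: x' + s n) => //; apply: eU; rewrite scale1r opprD addrA.
  by apply: le_lt_trans (hardy_normD _ _) _; rewrite hardy_normN [e]splitr ltrD.
rewrite linS scale1r sy; apply: dV; rewrite [_ + y']addrC opprD addrA.
by apply: le_lt_trans (hardy_normD _ _) _; rewrite hardy_normN [d]splitr ltrD.
Unshelve. all: by end_near. Qed.
End mixing.

(** * Exponential decay from asymptotic frequencies *)

Section frequencies.
Variable R : realType.
Implicit Types m p q r : R.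

Lemma cvg_expR_frequencies m1 m2 (a b : nat -> R) r1 r2 :
  m1 + m2 = 1 -> (forall n, a n + b n = n%:R) ->
  (forall e, 0 < e -> exists C : R, forall n, a n <= (m1 + e) * n%:R + C) ->
  (forall e, 0 < e -> exists C : R, forall n, b n <= (m2 + e) * n%:R + C) ->
  m1 * ln r1 + m2 * ln r2 < 0 ->
  expR (a n * ln r1 + b n * ln r2) @[n --> \oo] --> (0 : R).
Proof.
move=> m12 ab ha hb; move: (ln r1) (ln r2) => x y.
set L := _ + _ => L0.
pose D := `|x - y|; have D0 : 0 <= D by exact: normr_ge0.
(* The frequency error then costs at most half of the decay rate -L, since e * D <= - L / 2; the
   summand 1 avoids dividing by 0. *)
pose e := - L / 2 / (D + 1).
have e0 : 0 < e by rewrite !divr_gt0 ?oppr_gt0// ltr_wpDl.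
have [C1 hC1] := ha e e0; have [C2 hC2] := hb e e0.
pose C := `|C1| + `|C2|.
have bound n : expR (a n * x + b n * y) <= expR (C * D) * expR (L / 2) ^+ n.
  rewrite -expRM_natr -expRD ler_expR.
  pose d := a n - m1 * n%:R.
  (* The lower estimate on [a n] is the upper estimate on [b n], as a n + b n = n. *)
  have da : `|d| <= e * n%:R + C.
    have ? := hC1 n; have ? := hC2 n; have ? := ab n.
    have ? := ler_norm C1; have ? := ler_norm C2.
    have ? := normr_ge0 C1; have ? := normr_ge0 C2.
    have m2E : m2 = 1 - m1 by rewrite -m12 addrC addKr.
    have ? : (m1 + e) * n%:R = m1 * n%:R + e * n%:R by rewrite mulrDl.
    have ? : (m2 + e) * n%:R = n%:R - m1 * n%:R + e * n%:R.
      by rewrite m2E mulrDl mulrBl mul1r.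
    by rewrite ler_norml /d /C; apply/andP; split; lra.
  have -> : a n * x + b n * y = n%:R * L + d * (x - y).
    have -> : b n = n%:R - a n by rewrite -(ab n) addrC addKr.
    rewrite /L /d; have -> : m2 = 1 - m1 by rewrite -m12 addrC addKr.
    by ring.
  have h1 : d * (x - y) <= (e * n%:R + C) * D.
    apply: le_trans (ler_norm _) _; rewrite normrM ler_wpM2r//.
  have h2 : e * D <= - L / 2.
    rewrite /e -mulrA ler_piMr ?divr_ge0 ?oppr_ge0 ?(ltW L0)//.
    by rewrite mulrC ler_pdivrMr ?mul1r ?lerDl ?ltr_wpDl.
  have h3 : e * D * n%:R <= - L / 2 * n%:R by rewrite ler_wpM2r.
  have -> : n%:R * L = L / 2 * n%:R + L / 2 * n%:R.
    by rewrite -mulrDl -splitr mulrC.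
  have h4 : (e * n%:R + C) * D = e * D * n%:R + C * D by rewrite mulrDl mulrAC.
  have h5 : - L / 2 * n%:R = - (L / 2 * n%:R) by rewrite !mulNr.
  move: h1 h3; rewrite h4 h5.
  move: (d * _) (e * D * _) (C * D) (L / 2 * _) => a1 a2 a3 a4; lra.
apply: (@squeeze_cvgr _ _ _ _ (cst 0)
  (fun n => expR (C * D) * expR (L / 2) ^+ n)).
- by apply: nearW => n; rewrite expR_ge0/=; exact: bound.
- exact: cvg_cst.
- rewrite -[X in _ --> X](mulr0 (expR (C * D))); apply: cvgMl_tmp.
  by apply: cvg_expr; rewrite ger0_norm ?expR_ge0// expR_lt1 pmulr_llt0.
Qed.

(* The factor (1 + P^-1) / 2 moves P half of the way to 1. *)
Lemma powR_rescale m1 m2 p q (s := (1 + (p `^ m1 * q `^ m2)^-1) / 2) :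
  m1 + m2 = 1 -> 0 < p -> 0 < q ->
  0 < s /\ (p * s) `^ m1 * (q * s) `^ m2 = (p `^ m1 * q `^ m2 + 1) / 2.
Proof.
move=> m12 p0 q0.
have P0 : 0 < p `^ m1 * q `^ m2 by rewrite mulr_gt0 ?powR_gt0.
have s0 : 0 < s by rewrite divr_gt0// ltr_wpDr// invr_ge0 ltW.
split=> //; rewrite (powRM _ (ltW p0) (ltW s0)) (powRM _ (ltW q0) (ltW s0)).
rewrite mulrACA -powRD; last first.
  by rewrite (gt_eqF s0) implybT.
rewrite m12 powRr1 ?ltW// /s.
by move: P0; set P := _ * _ => P0; field; rewrite gt_eqF.
Qed.

(** This serves a vanishing modulus: [r1] may be as small as desired, and it is chosen to make the
    product 1/2. *)
Lemma powR_lt1_zero m1 m2 q : 0 < m1 -> 0 <= q ->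
  exists r1, exists r2, [/\ 0 < r1, q < r2 & r1 `^ m1 * r2 `^ m2 < 1].
Proof.
move=> m10 q0; pose c := (q + 1) `^ m2.
have c0 : 0 < c by rewrite powR_gt0// ltr_wpDl.
exists ((2 * c)^-1 `^ m1^-1), (q + 1); split.
- by rewrite powR_gt0// invr_gt0 mulr_gt0.
- by rewrite ltrDl.
- rewrite -powRrM mulVf ?gt_eqF// powRr1;
    last by rewrite invr_ge0 mulr_ge0 ?ltW.
  by rewrite -/c invfM -mulrA mulVf ?gt_eqF// mulr1 invf_lt1 ?ltr1n.
Qed.

Lemma powR_lt1_enlarge m1 m2 p q : 0 < m1 -> 0 < m2 -> m1 + m2 = 1 ->
  0 <= p -> 0 <= q -> p `^ m1 * q `^ m2 < 1 ->
  exists r1, exists r2, [/\ p < r1, q < r2 & r1 `^ m1 * r2 `^ m2 < 1].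
Proof.
move=> m10 m20 m12 p0 q0 pq.
have [->|pn] := eqVneq p 0; first exact: powR_lt1_zero.
have [->|qn] := eqVneq q 0.
  have [r2 [r1 [r20 pr1 h]]] := powR_lt1_zero m1 m20 p0.
  by exists r1, r2; rewrite mulrC.
have {}p0 : 0 < p by rewrite lt_def pn. have {}q0 : 0 < q by rewrite lt_def qn.
have [s0] := powR_rescale m12 p0 q0; set s := (_ / 2) in s0 *; move=> sE.
have s1 : 1 < s.
  have P0 : 0 < p `^ m1 * q `^ m2 by rewrite mulr_gt0 ?powR_gt0.
  have : 1 < (p `^ m1 * q `^ m2)^-1 by rewrite invf_gt1.
  by rewrite /s; lra.
exists (p * s), (q * s); split; rewrite ?ltr_pMr// sE; lra.
Qed.

Lemma powR_gt1_reduce m1 m2 p q : 0 < m1 -> 0 < m2 -> m1 + m2 = 1 ->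
  0 <= p -> 0 <= q -> 1 < p `^ m1 * q `^ m2 ->
  exists r1, exists r2,
    [/\ 0 < r1 < p, 0 < r2 < q & 1 < r1 `^ m1 * r2 `^ m2].
Proof.
move=> m10 m20 m12 p0 q0 pq.
(* A zero modulus would make the product 0, so here no degenerate case arises. *)
have pn : p != 0.
  by apply: contraTneq pq => ->; rewrite powR0 ?gt_eqF// mul0r -leNgt.
have qn : q != 0.
  by apply: contraTneq pq => ->; rewrite powR0 ?gt_eqF// mulr0 -leNgt.
have {}p0 : 0 < p by rewrite lt_def pn. have {}q0 : 0 < q by rewrite lt_def qn.
have [s0] := powR_rescale m12 p0 q0; set s := (_ / 2) in s0 *; move=> sE.
have s1 : s < 1.
  have P0 : 0 < p `^ m1 * q `^ m2 by rewrite mulr_gt0 ?powR_gt0.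
  have : (p `^ m1 * q `^ m2)^-1 < 1 by rewrite invf_lt1.
  by rewrite /s; lra.
exists (p * s), (q * s); split.
- by rewrite mulr_gt0// gtr_pMr.
- by rewrite mulr_gt0// gtr_pMr.
- by rewrite sE; lra.
Qed.

Lemma ln_powR2 m1 m2 r1 r2 : 0 < r1 -> 0 < r2 ->
  ln (r1 `^ m1 * r2 `^ m2) = m1 * ln r1 + m2 * ln r2.
Proof. by move=> r10 r20; rewrite lnM ?posrE ?powR_gt0// !ln_powR. Qed.

End frequencies.

Section holomorphic.
Variable R : realType.

Lemma holomorphic_disk_continuous (phi : R[i] -> R[i]) z :
  holomorphic_disk phi -> unit_disk z -> forall e : R, 0 < e ->
  exists2 r : R, 0 < r &
    forall w, normc (w - z) < r -> normc (phi w - phi z) < e.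
Proof.
move=> hphi z1 e e0.
have /derivable1_diffP/differentiable_continuous := hphi z z1.
move=> /cvgrPdist_lt /(_ (real_complex R e)); rewrite ltcR => /(_ e0).
move=> /nbhs_normP[[r i]]; rewrite /= ltcE /= => /andP[/eqP -> r0] h.
exists r => // w wz; have := h w.
rewrite /ball_ /= (_ : Complex r 0 = real_complex R r)//.
have -> : `|z - w| = real_complex R (normc (w - z)) by rewrite -normrN opprB.
have -> : `|phi z - phi w| = real_complex R (normc (phi w - phi z)).
  by rewrite -normrN opprB.
by rewrite !ltcR; apply.
Qed.
End holomorphic.

(** * Eigenvalues of the random products *)

Section random_eigenvalues.
Variable R : realType.
Implicit Types (x y : R[i]) (r : R).

Lemma normc_prod_le (chi : nat -> bool) x y r1 r2 n :
  0 < r1 -> 0 < r2 -> normc x <= r1 -> normc y <= r2 ->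
  normc (\prod_(k < n) (if chi k then x else y)) <=
  expR ((\sum_(k < n) (chi k)%:R) * ln r1 +
        (\sum_(k < n) (~~ chi k)%:R) * ln r2).
Proof.
move=> r10 r20 xr yr; elim: n => [|n ih].
  by rewrite !big_ord0 normc1 !mul0r addr0 expR0.
rewrite !big_ord_recr /= normcM !mulrDl addrACA expRD.
apply: ler_pM; rewrite ?normc_ge0//.
by case: (chi n); rewrite ?mul1r ?mul0r ?addr0 ?add0r lnK.
Qed.

(** In the final proof this serves twice: for the eigenvalues of kernels near the conjugate of
    [lambda], and for the inverse eigenvalues near the conjugate of [mu]. *)
Lemma normc_prod_cvg0 (chi : nat -> bool) x y r1 r2 m1 m2 :
  0 < r1 -> 0 < r2 -> normc x <= r1 -> normc y <= r2 ->
  m1 + m2 = 1 -> m1 * ln r1 + m2 * ln r2 < 0 ->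
  (forall e, 0 < e -> exists C : R, forall n,
    \sum_(k < n) (chi k)%:R <= (m1 + e) * n%:R + C) ->
  (forall e, 0 < e -> exists C : R, forall n,
    \sum_(k < n) (~~ chi k)%:R <= (m2 + e) * n%:R + C) ->
  normc (\prod_(k < n) (if chi k then x else y)) @[n --> \oo] --> (0 : R).
Proof.
move=> r10 r20 xr yr m12 rneg h1 h2.
apply: (@squeeze_cvgr _ _ _ _ (cst 0) (fun n =>
  expR ((\sum_(k < n) (chi k)%:R) * ln r1 +
        (\sum_(k < n) (~~ chi k)%:R) * ln r2))).
- by apply: nearW => n; rewrite normc_ge0 normc_prod_le.
- exact: cvg_cst.
- apply: (cvg_expR_frequencies m12) => // n.
  rewrite -big_split /= (eq_bigr (fun=> 1)) ?sumr_const ?card_ord// => i _.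
  by case: (chi i); rewrite ?addr0 ?add0r.
Qed.

Lemma random_product_linear (T : R -> hardy R -> hardy R) tau n w :
  (forall k a f g, T (iter k tau w) (a *: f + g) =
    a *: T (iter k tau w) f + T (iter k tau w) g) ->
  forall a f g, random_product T tau n w (a *: f + g) =
    a *: random_product T tau n w f + random_product T tau n w g.
Proof. by move=> linT a f g; elim: n => //= n ->; rewrite linT. Qed.

Lemma random_product_eigen (T : R -> hardy R -> hardy R) tau n w
    (c : nat -> R[i]) f :
  (forall k a g h, T (iter k tau w) (a *: g + h) =
    a *: T (iter k tau w) g + T (iter k tau w) h) ->
  (forall k, T (iter k tau w) f = c k *: f) ->
  random_product T tau n w f = (\prod_(k < n) c k) *: f.
Proof.
move=> linT Tf; elim: n => [|n ih] /=; first by rewrite big_ord0 scale1r.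
rewrite ih big_ord_recr /= -[X in T _ X]addr0 linT Tf scalerA.
have := linT n 1 0 0; rewrite scaler0 addr0 scale1r.
by rewrite -[X in X = _]addr0 => /addrI <-; rewrite addr0.
Qed.

Lemma normc_gt0 x : (0 < normc x) = (x != 0).
Proof.
rewrite lt_def normc_ge0 andbT; congr negb.
by apply/eqP/eqP => [/eq0_normc//|->]; rewrite normc0.
Qed.
End random_eigenvalues.

Theorem theorem1p3 (R : realType) (tau : R -> R) (A1 A2 : set R)
    (phi1 phi2 : R[i] -> R[i]) (T : R -> hardy R -> hardy R) :
  ergodic tau ->
  measurable A1 -> measurable A2 ->
  A1 `&` A2 = set0 -> A1 `|` A2 = circle R ->
  (0 < lebesgue_measure A1)%E -> (0 < lebesgue_measure A2)%E ->
  Hinfty phi1 -> Hinfty phi2 ->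
  nonconstant_disk phi1 -> nonconstant_disk phi2 ->
  (exists2 lambda : R[i], unit_disk lambda &
    normc (phi1 lambda) `^ fine (lebesgue_measure A1) *
    normc (phi2 lambda) `^ fine (lebesgue_measure A2) < 1) ->
  (exists2 mu : R[i], unit_disk mu &
    normc (phi1 mu) `^ fine (lebesgue_measure A1) *
    normc (phi2 mu) `^ fine (lebesgue_measure A2) > 1) ->
  (forall w, A1 w -> is_mul_op_adjoint phi1 (T w)) ->
  (forall w, A2 w -> is_mul_op_adjoint phi2 (T w)) ->
  {ae @lebesgue_measure R, forall w, circle R w ->
    topologically_mixing (fun n => random_product T tau n w)}.
Proof.
move=> erg mA1 mA2 A12 A12U A1pos A2pos [hol1 _] [hol2 _] _ _.
move=> [lambda lambda1 Hlambda] [mu mu1 Hmu] T1 T2.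
have A1c : A1 `<=` circle R by rewrite -A12U; exact: subsetUl.
have A2c : A2 `<=` circle R by rewrite -A12U; exact: subsetUr.
have leb1 : lebesgue_measure (circle R) = 1%E.
  by rewrite /circle lebesgue_measure_itv/= lte_fin ltr01 oppr0 adde0.
have fin (A : set R) : measurable A -> A `<=` circle R ->
    lebesgue_measure A \is a fin_num.
  move=> mA Ac; rewrite ge0_fin_numE//; apply: (@le_lt_trans _ _ 1%E);
    last exact: ltry.
  by rewrite -leb1; apply: le_measure; rewrite ?inE//; exact: measurable_circle.
have fin1 := fin _ mA1 A1c; have fin2 := fin _ mA2 A2c.
set m1 := fine (lebesgue_measure A1) in Hlambda Hmu.
set m2 := fine (lebesgue_measure A2) in Hlambda Hmu.
have m12 : m1 + m2 = 1.
  have U : (lebesgue_measure A1 + lebesgue_measure A2 = 1)%E.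
    by rewrite -leb1 -A12U measureU.
  by rewrite /m1 /m2 -fineD// U.
have m10 : 0 < m1 by rewrite fine_gt0// A1pos -ge0_fin_numE.
have m20 : 0 < m2 by rewrite fine_gt0// A2pos -ge0_fin_numE.
have [r1 [r2 [lr1 lr2 r12]]] := powR_lt1_enlarge m10 m20 m12
  (normc_ge0 _) (normc_ge0 _) Hlambda.
have [s1 [s2 [/andP[s10 ms1] /andP[s20 ms2] s12]]] :=
  powR_gt1_reduce m10 m20 m12 (normc_ge0 _) (normc_ge0 _) Hmu.
have r10 : 0 < r1 by exact: le_lt_trans (normc_ge0 _) lr1.
have r20 : 0 < r2 by exact: le_lt_trans (normc_ge0 _) lr2.
(* Continuity spreads the strict bounds at [lambda] and, through [near_ge], at [mu] to balls on
   which fixed constants control the moduli. *)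
have near_le (phi : R[i] -> R[i]) z r : holomorphic_disk phi -> unit_disk z ->
    normc (phi z) < r -> exists2 d : R, 0 < d &
    forall w, normc (w - z) < d -> normc (phi w) <= r.
  move=> hol z1 pr; have e0 : 0 < r - normc (phi z) by rewrite subr_gt0.
  have [d d0 hd] := holomorphic_disk_continuous hol z1 e0.
  exists d => // w /hd h; rewrite -(subrK (phi z) (phi w)).
  by apply: le_trans (le_normcD _ _) _; rewrite -lerBrDr ltW.
have near_ge (phi : R[i] -> R[i]) z r : holomorphic_disk phi -> unit_disk z ->
    r < normc (phi z) -> exists2 d : R, 0 < d &
    forall w, normc (w - z) < d -> r <= normc (phi w).
  move=> hol z1 pr; have e0 : 0 < normc (phi z) - r by rewrite subr_gt0.
  have [d d0 hd] := holomorphic_disk_continuous hol z1 e0.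
  exists d => // w /hd; rewrite -normcN opprB => h.
  by have := le_normcD (phi z - phi w) (phi w); rewrite subrK; lra.
have [d1 d10 hd1] := near_le _ _ _ hol1 lambda1 lr1.
have [d2 d20 hd2] := near_le _ _ _ hol2 lambda1 lr2.
have [e1 e10 he1] := near_ge _ _ _ hol1 mu1 ms1.
have [e2 e20 he2] := near_ge _ _ _ hol2 mu1 ms2.
have conjB (u z : R[i]) : normc (conjc u - z) = normc (u - conjc z).
  by rewrite -normc_conj rmorphB /= conjcK.
have [[tc _ _] _] := erg.
(* From here on [w] is fixed outside one null set, which depends on the visits to [A1] and [A2] but
   on no kernel. *)
move: (ae_circle_visits_le erg mA1 A1c) (ae_circle_visits_le erg mA2 A2c).
apply: filterS2; first exact: (ae_filter_ringOfSetsType lebesgue_measure).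
move=> w vis1 vis2 cw.
have ci k : circle R (iter k tau w) by exact: iter_circle.
pose chi k := iter k tau w \in A1.
have chiN k : (iter k tau w \in A2) = ~~ chi k.
  rewrite /chi; apply/idP/idP => [|/negP]; rewrite !inE.
    by move=> a2; apply/negP; rewrite inE => a1;
      rewrite -[False]/(set0 (iter k tau w)) -A12.
  by move=> na1; have := ci k; rewrite -A12U => -[].
pose x1 v := conjc (phi1 (conjc v)); pose x2 v := conjc (phi2 (conjc v)).
have linT k a f g : T (iter k tau w) (a *: f + g) =
    a *: T (iter k tau w) f + T (iter k tau w) g.
  have := ci k; rewrite -A12U => -[/T1|/T2] [M _ MT];
    exact: adjoint_linear MT _ _ _.
have eigT v k : unit_disk v -> T (iter k tau w) (cauchy_kernel v) =
    (if chi k then x1 v else x2 v) *: cauchy_kernel v.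
  move=> v1; case: ifP => ck.
    by apply: adjoint_kernel => //; apply: T1; rewrite -inE.
  by apply: adjoint_kernel => //; apply: T2; rewrite -inE chiN ck.
have f1 e : 0 < e -> exists C : R, forall n,
    \sum_(k < n) (chi k)%:R <= (m1 + e) * n%:R + C.
  by move=> e0; have [C hC] := vis1 cw e e0; exists C%:R => n; exact: hC.
have f2 e : 0 < e -> exists C : R, forall n,
    \sum_(k < n) (~~ chi k)%:R <= (m2 + e) * n%:R + C.
  move=> e0; have [C hC] := vis2 cw e e0; exists C%:R => n.
  apply: le_trans (hC n); rewrite le_eqVlt; apply/orP; left; apply/eqP.
  by apply: eq_bigr => k _; rewrite indicE chiN.
(* [cauchy_kernel v] reproduces values at [conjc v], so the balls are centred at the conjugates of
   [lambda] and [mu]. *)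
apply: (@kernels_mixing R _
  (fun n v => \prod_(k < n) (if chi k then x1 v else x2 v))
  (conjc lambda) (conjc mu) (Num.min d1 d2) (Num.min e1 e2)).
- by move=> n a f g; exact: random_product_linear.
- move=> n v v1.
  apply: (@random_product_eigen R T tau n w
    (fun k => if chi k then x1 v else x2 v)).
    exact: linT.
  by move=> k; exact: eigT.
- exact: unit_disk_conj.
- by rewrite lt_min d10.
- move=> v v1; rewrite lt_min => /andP[vd1 vd2].
  apply: (normc_prod_cvg0 (r1 := r1) (r2 := r2) (m1 := m1) (m2 := m2)) => //.
  + by rewrite normc_conj hd1// conjB.
  + by rewrite normc_conj hd2// conjB.
  + by rewrite -ln_powR2// ln_lt0// r12 mulr_gt0 ?powR_gt0.
- exact: unit_disk_conj.
- by rewrite lt_min e10.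
move=> v v1; rewrite lt_min => /andP[ve1 ve2].
have x1s : s1 <= normc (x1 v) by rewrite normc_conj he1// conjB.
have x2s : s2 <= normc (x2 v) by rewrite normc_conj he2// conjB.
have x1N : x1 v != 0 by rewrite -normc_gt0 (lt_le_trans s10).
have x2N : x2 v != 0 by rewrite -normc_gt0 (lt_le_trans s20).
split.
  by move=> n; apply/prodf_neq0 => k _; case: ifP.
(* The inverse eigenvalue is a product of inverses with moduli at most 1/s1 and 1/s2; the logarithms
   change sign, so growth at [mu] becomes the decay already proved. *)
rewrite (_ : (fun n => _) = fun n =>
    normc (\prod_(k < n) (if chi k then (x1 v)^-1 else (x2 v)^-1))); last first.
  apply/funext => n; congr normc.
  by rewrite -prodfV; apply: eq_bigr => k _; case: ifP.
apply: (normc_prod_cvg0 (r1 := s1^-1) (r2 := s2^-1) (m1 := m1) (m2 := m2)) =>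
  //.
- by rewrite invr_gt0.
- by rewrite invr_gt0.
- by rewrite normcV lef_pV2 ?posrE// (lt_le_trans s10).
- by rewrite normcV lef_pV2 ?posrE// (lt_le_trans s20).
- rewrite !lnV ?posrE// !mulrN -opprD oppr_lt0 -ln_powR2// ln_gt0//.
Qed.
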